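(* Let $(X,d)$ be a locally compact metric space, let $n\ge1$ and let $0<\alpha\le\frac{n}{n+1}$. Then $\mathcal D_n(X,d^\alpha)=\{0\}$. More generally, let $T\in\mathcal D_n(X)\setminus\{0\}$ and let $\alpha,\beta_1,\dots,\beta_n\in(0,1]$ satisfy $\alpha+\beta_1+\dots+\beta_n\le n$. Then there is no extension of $T$ to a function $$\bar T:\mathrm{H}^\alpha_c(X)\times \mathrm{H}^{\beta_1}_{\mathrm{loc}}(X)\times\dots\times \mathrm{H}^{\beta_n}_{\mathrm{loc}}(X)\to\mathbb R$$ with the following three properties: (1) $\bar T$ is $(n+1)$-linear; (2) $\bar T(f,\pi^1,\dots,\pi^n)=0$ if some $\pi^i$ is constant on a neighborhood of $\operatorname{spt}(f)$; (3) $\bar T(f_j,\pi_j)\to\bar T(f,\pi)$ for $j\to\infty$ whenever $f_j$ converges uniformly to $f$, the Hölder constants $\mathrm{H}^\alpha(f_j)$ are bounded in $j$ and there is a compact set containing $\operatorname{spt}(f_j)$ for all $j$, and for every compact set $K\subset X$ and $i=1,\dots,n$ the Hölder constants $\mathrm{H}^{\beta_i}(\pi^i_j|_K)$ are bounded in $j$ and $\pi^i_j|_K$ converges uniformly to $\pi^i|_K$.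
   Context: For a metric space $X$ and $\alpha\in(0,1]$, $\mathrm{H}^\alpha(X)$ is the set of $f:X\to\mathbb R$ with $|f(x)-f(x')|\le C\,d(x,x')^\alpha$ for some $C<\infty$ and all $x,x'$; the smallest such $C$ is $\mathrm{H}^\alpha(f)$. $\mathrm{H}^\alpha_c(X)$: those with compact support; $\mathrm{H}^\alpha_{\mathrm{loc}}(X)$: functions Hölder of order $\alpha$ near every point (equivalently, $X$ being locally compact, on every compact set). $\operatorname{Lip},\operatorname{Lip}_c,\operatorname{Lip}_{\mathrm{loc}}$ denote the case $\alpha=1$. Currents (in the sense of Lang): for a locally compact metric space $X$ let $\mathcal D^n(X)=\operatorname{Lip}_c(X)\times\prod_{i=1}^n\operatorname{Lip}_{\mathrm{loc}}(X)$. An $n$-dimensional current, $T\in\mathcal D_n(X)$, is a function $T:\mathcal D^n(X)\to\mathbb R$ that is $(n+1)$-linear; local, i.e. (if $n\ge1$) $T(f,\pi^1,\dots,\pi^n)=0$ whenever some $\pi^i$ is constant on a neighborhood of $\operatorname{spt}(f)$; and continuous, i.e. $T(f_j,\pi_j)\to T(f,\pi)$ whenever $f_j\to f$ uniformly with $\operatorname{Lip}(f_j)$ bounded and all $\operatorname{spt}(f_j)$ in a common compact set, and for every compact $K$ and every $i$, $\operatorname{Lip}(\pi^i_j|_K)$ is bounded in $j$ and $\pi^i_j|_K\to\pi^i|_K$ uniformly. $(X,d^\alpha)$ is the snowflake space, i.e. $X$ with the metric $d^\alpha$, and $\mathcal D_n(X,d^\alpha)$ is the space of $n$-dimensional currents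 in it. *)

(* Defs.v *)
From HB Require Import structures.
From mathcomp Require Import all_boot all_order all_algebra.
From mathcomp Require Import all_classical all_reals all_analysis.
Import Order.TTheory GRing.Theory Num.Theory.
Import numFieldNormedType.Exports.

Set Implicit Arguments.
Unset Strict Implicit.
Unset Printing Implicit Defensive.

Local Open Scope classical_set_scope.
Local Open Scope ring_scope.

Definition hoelder_bound (R : realType) (X : metricType R) (a : R) (A : set X)
    (f : X -> R) (C : R) : Prop :=
  0 <= C /\
  forall x y, A x -> A y -> `|f x - f y| <= C * mdist x y `^ a.

(* The smallest constant of the restriction of f to A; it is +oo when that
   restriction is not Hoelder. *)
Definition hoelder_const (R : realType) (X : metricType R) (a : R) (A : set X)
    (f : X -> R) : \bar R :=
  ereal_inf [set C%:E | C in hoelder_bound a A f].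

Definition spt (R : realType) (X : metricType R) (f : X -> R) : set X :=
  closure [set x | f x != 0].

Definition hoelder_c (R : realType) (X : metricType R) (a : R) : set (X -> R) :=
  [set f | (exists C, hoelder_bound a setT f C) /\ compact (spt f)].

Definition hoelder_loc (R : realType) (X : metricType R) (a : R) :
    set (X -> R) :=
  [set f | forall x : X, exists2 U, nbhs x U & exists C, hoelder_bound a U f C].

Arguments hoelder_c {R} X a.
Arguments hoelder_loc {R} X a.

Section Functionals.
Context {R : realType} {X : metricType R} {n : nat}.

Definition functional (a : R) (b : 'I_n -> R) : Type :=
  hoelder_c X a -> (forall i : 'I_n, hoelder_loc X (b i)) -> R.

Context {a : R} {b : 'I_n -> R}.
Implicit Types T : functional a b.

(* Linear combinations are expressed through the underlying functions, so that
   no vector space structure on the subtypes is needed. *)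
Definition multilinear T : Prop :=
  (forall (c : R) (f g h : hoelder_c X a) pi,
     (forall x, \val h x = c * \val f x + \val g x) ->
     T h pi = c * T f pi + T g pi) /\
  (forall (c : R) f pi (i : 'I_n) (p q r : hoelder_loc X (b i)),
     (forall x, \val r x = c * \val p x + \val q x) ->
     T f (dfwith pi i r) = c * T f (dfwith pi i p) + T f (dfwith pi i q)).

Definition is_local T : Prop :=
  forall (f : hoelder_c X a) (pi : forall i : 'I_n, hoelder_loc X (b i)) i,
    (exists2 U, set_nbhs (spt (\val f)) U &
       exists c : R, forall x, U x -> \val (pi i) x = c) ->
    T f pi = 0.

Definition seq_continuous T : Prop :=
  forall (f_ : nat -> hoelder_c X a)
         (pi_ : nat -> forall i : 'I_n, hoelder_loc X (b i))
         (f : hoelder_c X a) (pi : forall i : 'I_n, hoelder_loc X (b i)),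
    {uniform, (fun j => \val (f_ j)) @ \oo --> \val f} ->
    (exists M : R, forall j, (hoelder_const a setT (\val (f_ j)) <= M%:E)%E) ->
    (exists2 K : set X, compact K & forall j, spt (\val (f_ j)) `<=` K) ->
    (forall (K : set X) (i : 'I_n), compact K ->
       (exists M : R, forall j,
          (hoelder_const (b i) K (\val (pi_ j i)) <= M%:E)%E) /\
       {uniform K, (fun j => \val (pi_ j i)) @ \oo --> \val (pi i)}) ->
    T (f_ j) (pi_ j) @[j --> \oo] --> T f pi.

End Functionals.
Arguments functional {R} X n a b.

Definition currents (R : realType) (X : metricType R) (n : nat) :
    set (functional X n 1 (fun=> 1)) :=
  [set T | [/\ multilinear T, is_local T & seq_continuous T]].
Arguments currents {R} X n.

(* Lip_c(X) is contained in H^a_c(X) and Lip_loc(X) in H^b_loc(X), for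
   exponents in (0, 1]; elements of the two domains are compared through their
   underlying functions. *)
Definition extends (R : realType) (X : metricType R) (n : nat) (a : R)
    (b : 'I_n -> R) (T : functional X n 1 (fun=> 1))
    (Tbar : functional X n a b) : Prop :=
  forall f pi g rho,
    \val g = \val f :> (X -> R) ->
    (forall i, \val (rho i) = \val (pi i) :> (X -> R)) ->
    Tbar g rho = T f pi.

Definition snowflake (R : realType) (X : metricType R) (a : R)
  (a01 : 0 < a <= 1) : Type := X.
Arguments snowflake {R} X {a} a01.

Section Snowflake.
Context {R : realType} (X : metricType R) (a : R) (a01 : 0 < a <= 1).

HB.instance Definition _ := Choice.copy (snowflake X a01) X.

Let dist (x y : snowflake X a01) : R := @mdist R X x y `^ a.

Let dist_xx x : dist x x = 0.
Proof. by case/andP: a01 => a0 _; rewrite /dist mdistxx powR0 ?gt_eqF. Qed.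

Let dist_positivity x y : dist x y = 0 -> x = y.
Proof. by move/powR_eq0_eq0; exact: mdist_positivity. Qed.

Let dist_sym x y : dist x y = dist y x.
Proof. by rewrite /dist metric_sym. Qed.

Let powR_sub (s t : R) : 0 <= s -> 0 <= t ->
  (s + t) `^ a <= s `^ a + t `^ a.
Proof.
case/andP: a01 => a0 a1 s0 t0.
have [st|st] := eqVneq (s + t) 0.
  by rewrite st powR0 ?gt_eqF// addr_ge0 ?powR_ge0.
have st0 : 0 < s + t by rewrite lt_neqAle eq_sym st addr_ge0.
have key u : 0 <= u -> u <= s + t -> u / (s + t) * (s + t) `^ a <= u `^ a.
  move=> u0 ust; have q0 : 0 <= u / (s + t) by rewrite divr_ge0// ltW.
  have {2}-> : u = u / (s + t) * (s + t) by rewrite divfK.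
  rewrite powRM ?(ltW st0)// ler_wpM2r ?powR_ge0//.
  have [->|qn0] := eqVneq (u / (s + t)) 0; first exact: powR_ge0.
  by rewrite ger1_powR// lt_neqAle eq_sym qn0 q0 ler_pdivrMr// mul1r.
rewrite -[leLHS]mul1r -(divff st) mulrDl mulrDl.
by rewrite lerD// key// ?lerDl ?lerDr.
Qed.

Let dist_triangle y x z : dist x z <= dist x y + dist y z.
Proof.
case/andP: a01 => a0 _; apply: le_trans (powR_sub _ _); rewrite ?mdist_ge0//.
by rewrite ge0_ler_powR ?nnegrE ?addr_ge0 ?mdist_ge0 ?metric_triangle// ltW.
Qed.

HB.instance Definition _ := isMetric.Build R (snowflake X a01)
  dist_xx dist_positivity dist_sym dist_triangle.

End Snowflake.

(* Main.v *)
Require Import Defs.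
From mathcomp Require Import all_boot all_order all_algebra ring lra.
From mathcomp Require Import all_classical all_reals all_analysis.
Import Order.TTheory GRing.Theory Num.Theory.
Import numFieldNormedType.Exports.

Set Implicit Arguments.
Unset Strict Implicit.
Unset Printing Implicit Defensive.

Local Open Scope classical_set_scope.
Local Open Scope ring_scope.

(* Let d(t) be the distance from t to the integers and w(t) = 1/4 - d(t - 1/4),
   a triangle wave whose sign is the slope of d.  Locality gives, for Lipschitz
   u, the exact identity T(f |w(u)|, .., u, ..) = T(f w(u), .., d(u), ..), since
   d(u) - u and d(u) + u are integer valued where w(u) > 0 and w(u) < 0.
   As |w(t)| + |w(t + 1/4)| = 1/4, some shift s in {0, 1/4} satisfies
   |T(f, .., u, ..)| <= 8 |T(f w(u + s), .., d(u + s), ..)|.  Doing this in every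
   slot with u = pi^i / e bounds |T(f, pi)| by
   8^n e^(n - a - sum b_i) |T(F, G)| with F = e^a f prod_i w(pi^i / e + s_i) and
   G^i = e^(b_i) d(pi^i / e + s_i).  The exponent of e is nonnegative, while F and
   G tend to 0 uniformly with bounded Hoelder constants as e tends to 0, so the
   continuity of T forces T(f, pi) = 0 for all Lipschitz f and pi.  Lipschitz
   functions are dense in the sense of that continuity (inf-convolutions), so T
   vanishes identically.  For the snowflake, a current in (X, d^a) is such a
   functional on X with all exponents equal to a. *)

(** * Hoelder functions on a metric space *)

Section HoelderFunctions.
Context {R : realType} {X : metricType R}.
Implicit Types (f g : X -> R) (A K : set X) (a C : R).

Lemma ball_mdist (x y : X) (r : R) : ball x r y = (mdist x y < r) :> Prop.
Proof. by rewrite ballEmdist. Qed.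

(** The tool for functions oscillating at scale [e]: the first hypothesis settles distances above
    [e], where [(d/e)^a >= 1], and the second those up to [e], where [d/e <= (d/e)^a] because
    [a <= 1]. The resulting constant [B] is free of [e]. *)
Lemma hoelder_bound_interp a A f e B : 0 < a <= 1 -> 0 < e -> 0 <= B ->
    (forall x y, A x -> A y -> `|f x - f y| <= e `^ a * B) ->
    (forall x y, A x -> A y -> `|f x - f y| <= e `^ a * B * (mdist x y / e)) ->
  hoelder_bound a A f B.
Proof.
move=> /andP[a0 a1] e0 B0 fB fL; split => // x y Ax Ay.
have ea0 := powR_gt0 a e0.
have [de|ed] := leP (mdist x y) e; last first.
  apply: le_trans (fB _ _ Ax Ay) _; rewrite mulrC ler_wpM2l//.
  by rewrite ge0_ler_powR ?nnegrE ?(ltW a0) ?(ltW e0) ?mdist_ge0// ltW.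
apply: le_trans (fL _ _ Ax Ay) _.
rewrite (mulrC (e `^ a)) -mulrA ler_wpM2l//.
have [d0|dn0] := eqVneq (mdist x y) 0; first by rewrite d0 mul0r mulr0 powR_ge0.
have dgt0 : 0 < mdist x y by rewrite lt_neqAle eq_sym dn0 mdist_ge0.
have {2}-> : mdist x y = e * (mdist x y / e) by rewrite mulrC divfK ?gt_eqF.
rewrite powRM ?(ltW e0) ?divr_ge0 ?mdist_ge0 ?(ltW e0)// ler_wpM2l ?(ltW ea0)//.
by rewrite ger1_powR// divr_gt0//= ler_pdivrMr// mul1r.
Qed.

Lemma hoelder_bound1P A f C : hoelder_bound 1 A f C <->
  0 <= C /\ forall x y, A x -> A y -> `|f x - f y| <= C * mdist x y.
Proof.
split=> -[C0 fC]; split=> // x y Ax Ay; have := fC _ _ Ax Ay;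
  by rewrite powRr1 ?mdist_ge0.
Qed.

Lemma hoelder_boundS a A B f C : A `<=` B -> hoelder_bound a B f C ->
  hoelder_bound a A f C.
Proof. by move=> AB [C0 fC]; split => // x y /AB Ax /AB Ay; exact: fC. Qed.

Lemma hoelder_bound_comp a A f C (h : R -> R) :
    (forall s t, `|h s - h t| <= `|s - t|) ->
  hoelder_bound a A f C -> hoelder_bound a A (h \o f) C.
Proof. by move=> h1 [C0 fC]; split=> // x y Ax Ay; apply: le_trans (h1 _ _) _; exact: fC. Qed.

Lemma hoelder_boundD a A f g C D : hoelder_bound a A f C ->
  hoelder_bound a A g D -> hoelder_bound a A (fun x => f x + g x) (C + D).
Proof.
move=> [C0 fC] [D0 gD]; split; first exact: addr_ge0.
move=> x y Ax Ay; rewrite opprD addrACA (le_trans (ler_normD _ _))// mulrDl.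
by rewrite lerD ?fC ?gD.
Qed.

Lemma hoelder_boundZ a A f c C : hoelder_bound a A f C ->
  hoelder_bound a A (fun x => c * f x) (`|c| * C).
Proof.
move=> [C0 fC]; split; first by rewrite mulr_ge0.
by move=> x y Ax Ay; rewrite -mulrBr normrM -mulrA ler_wpM2l// fC.
Qed.

Lemma hoelder_bound_cst a A c : hoelder_bound a A (fun=> c) 0.
Proof. by split=> // x y _ _; rewrite subrr normr0 mul0r. Qed.

Lemma hoelder_boundM a A f g C D M N : 0 <= M -> 0 <= N ->
    (forall x, A x -> `|f x| <= M) -> (forall x, A x -> `|g x| <= N) ->
    hoelder_bound a A f C -> hoelder_bound a A g D ->
  hoelder_bound a A (fun x => f x * g x) (C * N + M * D).
Proof.
move=> M0 N0 fM gN [C0 fC] [D0 gD]; split; first by rewrite addr_ge0 ?mulr_ge0.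
move=> x y Ax Ay.
have -> : f x * g x - f y * g y = (f x - f y) * g x + f y * (g x - g y) by ring.
rewrite (le_trans (ler_normD _ _))// !normrM mulrDl lerD//.
  by rewrite mulrAC ler_pM ?fC ?gN.
by rewrite -mulrA ler_pM ?gD ?fM.
Qed.

Lemma hoelder_bound_loc b g C : hoelder_bound b setT g C -> hoelder_loc X b g.
Proof. by move=> gC x; exists setT; [exact: filterT|exists C]. Qed.

Lemma hoelder_loc_ball b g x : hoelder_loc X b g ->
  exists2 r : R, 0 < r & exists C, hoelder_bound b (ball x r) g C.
Proof.
move=> /(_ x) [U /nbhs_ballP [r /= r0 rU] [C gC]]; exists r => //.
by exists C; exact: hoelder_boundS gC.
Qed.

Lemma spt_id f x : f x != 0 -> spt f x.
Proof. by move=> fx; apply: subset_closure. Qed.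

Lemma spt_sub f g : (forall x, f x != 0 -> g x != 0) -> spt f `<=` spt g.
Proof. by move=> fg; apply: closure_subset => x /=; exact: fg. Qed.

Lemma spt_compact f K : compact K -> spt f `<=` K -> compact (spt f).
Proof. by move=> cK fK; apply: subclosed_compact fK => //; exact: closed_closure. Qed.

Lemma hoelder_loc_bounded b g K : 0 <= b -> hoelder_loc X b g -> compact K ->
  exists2 M, 0 <= M & forall x, K x -> `|g x| <= M.
Proof.
move=> b0 gb /compact_near_coveringP cK.
(* Compactness is used in its near-covering form, with the bound [M] itself as the parameter going
   to [+oo]: around each point, all large [M] work. *)
have : \forall M \near +oo, K `<=` [set x | `|g x| <= M].
  apply: (cK R +oo (fun M x => `|g x| <= M)) => x Kx.
  have [r r0 [C [C0 gC]]] := hoelder_loc_ball x gb.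
  exists (ball x r, [set M | `|g x| + C * r `^ b <= M]).
    split=> /=; first exact: nbhsx_ballx.
    exact: nbhs_pinfty_ge (num_real _).
  move=> [y M] /= [xy]; apply: le_trans.
  rewrite -lerBlDl (le_trans (lerB_dist _ _))//.
  apply: le_trans (gC y x xy (ballxx _ r0)) _; rewrite ler_wpM2l//.
  rewrite ge0_ler_powR ?nnegrE ?mdist_ge0 ?(ltW r0)// metric_sym.
  by move: xy; rewrite ball_mdist => /ltW.
move=> gM; near (+oo : set_system R) => M; exists M; first by near: M; exact: nbhs_pinfty_ge (num_real _).
exact: (near gM M).
Unshelve. all: by end_near. Qed.

(* Points of K close to x are compared through the local estimate at x, the
   others through the bound for |g| on K. *)
Lemma hoelder_loc_compact b g K : 0 <= b -> hoelder_loc X b g -> compact K ->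
  exists C, hoelder_bound b K g C.
Proof.
move=> b0 gb cK; have [M M0 gM] := hoelder_loc_bounded b0 gb cK.
move/compact_near_coveringP : (cK) => nK.
pose P C x := K x -> forall y, K y -> `|g x - g y| <= C * mdist x y `^ b.
have : \forall C \near +oo, K `<=` P C.
  apply: nK => x Kx; have [r r0 [C [C0 gC]]] := hoelder_loc_ball x gb.
  have r20 : 0 < r / 2 by rewrite divr_gt0.
  exists (ball x (r / 2), [set D | Num.max C ((M + M) / (r / 2) `^ b) <= D]).
    split=> /=; first exact: nbhsx_ballx.
    exact: nbhs_pinfty_ge (num_real _).
  move=> [y D] /= [xy]; rewrite ge_max => /andP[CD rD] Ky z Kz.
  have [yz|yz] := ltP (mdist y z) (r / 2).
    have xz : ball x r z.
      by rewrite [r]splitr; apply: ball_triangle xy _; rewrite ball_mdist.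
    have xy' : ball x r y by apply: le_ball xy; lra.
    by apply: le_trans (gC _ _ xy' xz) _; rewrite ler_wpM2r ?powR_ge0.
  apply: (@le_trans _ _ (M + M)); first by rewrite (le_trans (ler_normB _ _))// lerD ?gM.
  move: rD; rewrite ler_pdivrMr ?powR_gt0// => /le_trans; apply.
  have D0 := le_trans C0 CD.
  rewrite ler_wpM2l// ge0_ler_powR ?nnegrE ?mdist_ge0//.
  exact: ltW.
move=> gC; near (+oo : set_system R) => C; exists C; split.
  by near: C; exact: nbhs_pinfty_ge (num_real _).
by move=> x y Kx Ky; apply: (near gC C).
Unshelve. all: by end_near. Qed.

Lemma hoelder_c_bounded a f : 0 <= a -> hoelder_c X a f ->
  exists2 M, 0 <= M & forall x, `|f x| <= M.
Proof.
move=> a0 [[C fC] cf].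
have [M M0 fM] := hoelder_loc_bounded a0 (hoelder_bound_loc fC) cf.
exists M => // x; have [->|/spt_id/fM//] := eqVneq (f x) 0.
by rewrite normr0.
Qed.

Lemma hoelder_cD a c f g : hoelder_c X a f -> hoelder_c X a g ->
  hoelder_c X a (fun x => c * f x + g x).
Proof.
move=> [[C fC] cf] [[D gD] cg]; split.
  by exists (`|c| * C + D); apply: hoelder_boundD => //; exact: hoelder_boundZ.
apply: (@spt_compact _ (spt f `|` spt g)); first exact: compactU.
rewrite /spt -closureU; apply: closure_subset => x /=.
by have [->|] := eqVneq (f x) 0; [rewrite mulr0 add0r; right|left].
Qed.

Lemma hoelder_locD b c f g : hoelder_loc X b f -> hoelder_loc X b g ->
  hoelder_loc X b (fun x => c * f x + g x).
Proof.
move=> fb gb x; have [U xU [C fC]] := fb x; have [V xV [D gD]] := gb x.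
exists (U `&` V); first exact: filterI.
exists (`|c| * C + D); apply: hoelder_boundD.
  by apply: hoelder_boundZ; apply: hoelder_boundS fC.
by apply: hoelder_boundS gD.
Qed.

Lemma hoelder_c0 a : hoelder_c X a (fun=> 0).
Proof.
split; first by exists 0; exact: hoelder_bound_cst.
apply: (@spt_compact _ set0); first exact: compact0.
by rewrite /spt -[X in _ `<=` X]closure0; apply: closure_subset => x /=; rewrite eqxx.
Qed.

Lemma hoelder_loc0 b : hoelder_loc X b (fun=> 0).
Proof. exact: hoelder_bound_loc (hoelder_bound_cst _ _ _). Qed.

Lemma hoelder_c_mul a f g C N : 0 <= a -> hoelder_c X a f ->
    hoelder_bound a setT g C -> 0 <= N -> (forall x, `|g x| <= N) ->
  hoelder_c X a (fun x => f x * g x).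
Proof.
move=> a0 fc gC N0 gN; have [M M0 fM] := hoelder_c_bounded a0 fc.
case: fc => -[D fD] cf; split.
  by exists (D * N + M * C); apply: hoelder_boundM.
apply: spt_compact cf _; apply: spt_sub => x; apply: contra_neq => ->.
exact: mul0r.
Qed.

Lemma hoelder_c_lip a f : 0 < a <= 1 -> hoelder_c X 1 f -> hoelder_c X a f.
Proof.
move=> a01 fc; have [M M0 fM] := hoelder_c_bounded ler01 fc.
case: fc => -[C /hoelder_bound1P [C0 fC]] cf; split => //.
(* Interpolation at scale 1: [C] serves short distances, and the oscillation [M + M] long ones. *)
exists (Num.max C (M + M)).
apply: (@hoelder_bound_interp a setT f 1) => //.
- by rewrite le_max C0.
- move=> x y _ _; rewrite powR1 mul1r (le_trans (ler_normB _ _))//.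
  by rewrite le_max lerD ?orbT.
- move=> x y _ _; rewrite powR1 mul1r divr1 (le_trans (fC _ _ _ _))//.
  by rewrite ler_wpM2r ?mdist_ge0// le_max lexx.
Qed.

Lemma hoelder_loc_lip b g : 0 < b <= 1 -> hoelder_loc X 1 g -> hoelder_loc X b g.
Proof.
move=> b01 gl x; have [r r0 [C /hoelder_bound1P [C0 gC]]] := hoelder_loc_ball x gl.
(* A radius of at most 1/2 keeps the points of the ball within distance 1 of each other, so the
   Lipschitz constant [C] also bounds the oscillation in the interpolation at scale 1. *)
pose s := Num.min r (1 / 2).
exists (ball x s); first by apply: nbhsx_ballx; rewrite lt_min r0 divr_gt0.
exists C; apply: (@hoelder_bound_interp b _ g 1) => // y z xy xz.
all: rewrite powR1 mul1r ?divr1.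
all: have sr : s <= r by rewrite ge_min lexx.
  apply: le_trans (gC _ _ (le_ball sr xy) (le_ball sr xz)) _.
  rewrite ler_piMr//; move: xy xz; rewrite !ball_mdist => xy xz.
  apply: le_trans (metric_triangle _ x _) _; rewrite metric_sym [leRHS]splitr.
  have s2 : s <= 1 / 2 by rewrite ge_min lexx orbT.
  by rewrite lerD// (le_trans (ltW _) s2).
by apply: gC; exact: le_ball sr _ _.
Qed.

Lemma powR_small (r e : R) : 0 < r -> 0 < e ->
  exists2 d, 0 < d & forall x, 0 <= x < d -> x `^ r < e.
Proof.
move=> r0 e0; exists (e `^ r^-1); first exact: powR_gt0.
move=> x /andP[x0 xd]; have := gt0_ltr_powR r0 (x := x) (y := e `^ r^-1).
rewrite !nnegrE powR_ge0 x0 -powRrM mulVf ?gt_eqF// powRr1 ?ltW//.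
by apply.
Qed.

Lemma cvg_invn_powR (r : R) : 0 < r ->
  (j.+1%:R^-1 : R) `^ r @[j --> \oo] --> (0 : R).
Proof.
move=> r0; apply/cvgrPdist_lt => e e0; have [d d0 dP] := powR_small r0 e0.
near=> j; rewrite sub0r normrN ger0_norm ?powR_ge0// dP// invr_ge0 ler0n/=.
by near: j; exact: near_infty_natSinv_lt (PosNum d0).
Unshelve. all: by end_near. Qed.

Lemma hoelder_bound_near a f C (x : X) (e : R) : 0 < a -> hoelder_bound a setT f C ->
  0 < e -> \forall y \near x, `|f x - f y| < e.
Proof.
move=> a0 [C0 fC] e0; have C1 : 0 < C + 1 by rewrite ltr_wpDl.
have [d d0 dP] := powR_small a0 (divr_gt0 e0 C1).
apply: filterS (nbhsx_ballx x _ d0) => y; rewrite ball_mdist => xy.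
apply: le_lt_trans (fC x y I I) _.
apply: (@le_lt_trans _ _ ((C + 1) * mdist x y `^ a)).
  by rewrite ler_wpM2r ?powR_ge0// lerDl.
by rewrite mulrC -ltr_pdivlMr// dP// mdist_ge0.
Qed.

Lemma cvg_uniform_dist (F : nat -> X -> R) f A (u : nat -> R) :
    (forall j x, A x -> `|F j x - f x| <= u j) -> u j @[j --> \oo] --> 0 ->
  {uniform A, (fun j => F j) @ \oo --> f}.
Proof.
move=> Fu u0 P /uniform_nbhs [E [entE EP]].
move: entE; rewrite -entourage_ballE => -[e /= e0 eE].
have := u0 _ (nbhsx_ballx 0 e e0); rewrite nbhs_simpl => ue.
near=> j; apply: EP => x Ax; apply: eE => /=.
rewrite /ball/= distrC (le_lt_trans (Fu _ _ Ax))//.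
have : ball 0 e (u j) by near: j.
by rewrite /ball/= sub0r normrN; apply: le_lt_trans; exact: ler_norm.
Unshelve. all: by end_near. Qed.

End HoelderFunctions.

(** * Triangle waves *)

Section TriangleWaves.
Context {R : realType}.
Implicit Types (s t : R) (m : int).

(** [floor (t + 1/2)] is an integer nearest to [t], so this is the distance to the integers;
    [distZ_le] gives the minimality. *)
Definition distZ t : R := `|t - (Num.floor (t + 1 / 2))%:~R|.

Lemma distZ_le12 t : distZ t <= 1 / 2.
Proof.
rewrite /distZ; have := floor_itv (t + 1 / 2).
by rewrite intrD => /andP[? ?]; rewrite ler_norml; lra.
Qed.

Lemma distZ_le t m : distZ t <= `|t - m%:~R|.
Proof.
rewrite /distZ; set k := Num.floor _; have := floor_itv (t + 1 / 2).
rewrite -/k intrD => /andP[kt tk].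
have [mk|km|->//] := ltgtP m k.
  have : (m + 1)%:~R <= k%:~R :> R by rewrite ler_int lezD1.
  by rewrite intrD => ?; apply: le_trans (ler_norm _); rewrite ler_norml; lra.
have : (k + 1)%:~R <= m%:~R :> R by rewrite ler_int lezD1.
by rewrite intrD => ?; rewrite [leRHS]distrC; apply: le_trans (ler_norm _); rewrite ler_norml; lra.
Qed.

Lemma distZE t m : `|t - m%:~R| <= 1 / 2 -> distZ t = `|t - m%:~R|.
Proof.
move=> tm; apply/le_anti; rewrite distZ_le/= /distZ.
set k := Num.floor _; have := floor_itv (t + 1 / 2).
rewrite -/k intrD => /andP[kt tk].
have [mk|km|->//] := ltgtP m k.
  have : (m + 1)%:~R <= k%:~R :> R by rewrite ler_int lezD1.
  rewrite intrD => ?; rewrite [leRHS]distrC; apply: le_trans (ler_norm _).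
  move: tm; rewrite !ler_norml => /andP[? ?]; lra.
have : (k + 1)%:~R <= m%:~R :> R by rewrite ler_int lezD1.
rewrite intrD => ?; apply: le_trans (ler_norm _).
move: tm; rewrite !ler_norml => /andP[? ?]; lra.
Qed.

Lemma distZ_lip s t : `|distZ s - distZ t| <= `|s - t|.
Proof.
wlog st : s t / distZ t <= distZ s.
  by move=> h; have [/h//|/ltW/h] := leP (distZ t) (distZ s); rewrite distrC (distrC t).
rewrite ger0_norm ?subr_ge0// lerBlDr.
apply: le_trans (distZ_le s (Num.floor (t + 1 / 2))) _.
by rewrite /distZ (le_trans _ (ler_normD _ _))// addrA subrK.
Qed.

Definition wave t : R := 1 / 4 - distZ (t - 1 / 4).

Lemma wave_lip s t : `|wave s - wave t| <= `|s - t|.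
Proof.
have -> : wave s - wave t = distZ (t - 1 / 4) - distZ (s - 1 / 4).
  by rewrite /wave; ring.
apply: le_trans (distZ_lip _ _) _; rewrite [leRHS]distrC.
by have -> : t - 1 / 4 - (s - 1 / 4) = t - s by ring.
Qed.

Lemma norm_distZ_le1 t : `|distZ t| <= 1.
Proof.
rewrite ger0_norm ?normr_ge0//.
by rewrite (le_trans (distZ_le12 t))// ler_pdivrMr// mul1r ler1n.
Qed.

Lemma norm_wave_le1 t : `|wave t| <= 1.
Proof.
have := distZ_le12 (t - 1 / 4); have : 0 <= distZ (t - 1 / 4) by exact: normr_ge0.
by rewrite /wave => ? ?; rewrite ler_norml; lra.
Qed.

(* The sign of the wave is the slope of distZ. *)
Lemma wave_distZ t : exists m,
  (0 <= wave t /\ distZ t = t - m%:~R) \/ (wave t < 0 /\ distZ t = m%:~R - t).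
Proof.
pose k := Num.floor t; have := floor_itv t; rewrite -/k intrD => /andP[kt tk].
have [h|h] := leP (t - k%:~R) (1 / 2).
  exists k; left; rewrite /wave (@distZE (t - 1 / 4) k); last by rewrite ler_norml; lra.
  rewrite (@distZE t k); last by rewrite ler_norml; lra.
  rewrite [`|t - k%:~R|]ger0_norm; last lra.
  by split=> //; rewrite subr_ge0 ler_norml; lra.
exists (k + 1); right; rewrite (@distZE t (k + 1)) intrD; last by rewrite ler_norml; lra.
rewrite ler0_norm; last lra.
split; last by lra.
rewrite /wave; have [g|g] := leP (t - k%:~R) (3 / 4).
  rewrite (@distZE (t - 1 / 4) k); last by rewrite ler_norml; lra.
  by rewrite subr_lt0 ger0_norm; lra.
rewrite (@distZE (t - 1 / 4) (k + 1)) intrD; last by rewrite ler_norml; lra.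
by rewrite subr_lt0 ler0_norm; lra.
Qed.

(** The shift by 1/4 turns the wave into [1/4 - distZ t], while [|wave t|] is the tent
    [1/4 - |1/4 - distZ t|]. Both are checked on the pieces of one period. *)
Lemma wave_partition t : `|wave t| + `|wave (t + 1 / 4)| = 1 / 4.
Proof.
rewrite /wave addrK.
pose k := Num.floor t; have := floor_itv t; rewrite -/k intrD => /andP[kt tk].
have [h|h] := leP (t - k%:~R) (1 / 2).
  rewrite (@distZE (t - 1 / 4) k); last by rewrite ler_norml; lra.
  rewrite (@distZE t k); last by rewrite ler_norml; lra.
  rewrite [`|t - k%:~R|]ger0_norm; last lra.
  rewrite [`|1 / 4 - (t - k%:~R)|]distrC.
  have -> : t - k%:~R - 1 / 4 = t - 1 / 4 - k%:~R by ring.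
  by rewrite ger0_norm ?subrK// subr_ge0 ler_norml; lra.
rewrite (@distZE t (k + 1)) intrD; last by rewrite ler_norml; lra.
rewrite (@ler0_norm _ (t - _)); last lra.
have [g|g] := leP (t - k%:~R) (3 / 4).
  rewrite (@distZE (t - 1 / 4) k); last by rewrite ler_norml; lra.
  rewrite (@ger0_norm _ (t - 1 / 4 - k%:~R)); last lra.
  by rewrite !ler0_norm; lra.
rewrite (@distZE (t - 1 / 4) (k + 1)) intrD; last by rewrite ler_norml; lra.
rewrite (@ler0_norm _ (t - 1 / 4 - _)); last lra.
by rewrite ler0_norm ?ger0_norm; lra.
Qed.

(** The projection of the line onto [0, 1]. On natural numbers it separates 0 from the positive
    ones, which is how it enters [hc_slot_nat]. *)
Definition clamp t : R := Num.max 0 t - Num.max 0 (t - 1).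

Lemma clamp_lip s t : `|clamp s - clamp t| <= `|s - t|.
Proof.
rewrite /clamp; wlog st : s t / s <= t.
  by move=> h; have [/h//|/ltW/h] := leP s t; rewrite distrC (distrC t).
rewrite (ler0_norm (x := s - t)) ?subr_le0// ler_norml.
case: (leP 0 s) => ?; case: (leP 0 t) => ?;
case: (leP 0 (s - 1)) => ?; case: (leP 0 (t - 1)) => ?; lra.
Qed.

Lemma norm_clamp_le1 t : `|clamp t| <= 1.
Proof. by rewrite /clamp ler_norml; case: (leP 0 t) => ?; case: (leP 0 (t - 1)) => ?; lra. Qed.

(** Soft thresholding: for [d >= 0] it moves [t] towards 0 by [d] and stops at 0. It shrinks
    supports without increasing Hölder constants. *)
Definition truncation (d t : R) : R := Num.max 0 (t - d) - Num.max 0 (- t - d).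

Lemma truncation_lip d s t : 0 <= d -> `|truncation d s - truncation d t| <= `|s - t|.
Proof.
move=> d0; rewrite /truncation; wlog st : s t / s <= t.
  by move=> h; have [/h//|/ltW/h] := leP s t; rewrite distrC (distrC t).
rewrite (ler0_norm (x := s - t)) ?subr_le0// ler_norml.
case: (leP 0 (s - d)) => ?; case: (leP 0 (t - d)) => ?;
case: (leP 0 (- s - d)) => ?; case: (leP 0 (- t - d)) => ?; lra.
Qed.

Lemma truncation_dist d t : 0 <= d -> `|truncation d t - t| <= d.
Proof.
move=> d0; rewrite /truncation ler_norml.
by case: (leP 0 (t - d)) => ?; case: (leP 0 (- t - d)) => ?; lra.
Qed.

Lemma truncation_eq0 d t : `|t| <= d -> truncation d t = 0.
Proof.
rewrite ler_norml /truncation => /andP[? ?].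
by case: (leP 0 (t - d)) => ?; case: (leP 0 (- t - d)) => ?; lra.
Qed.

End TriangleWaves.

(** * Locality *)

(* A functional on bare functions; its values matter only on
   H^a_c x H^(b_1)_loc x ... x H^(b_n)_loc. *)
Record hoelder_current (R : realType) (X : metricType R) (n : nat) (a : R)
    (b : 'I_n -> R) (T : (X -> R) -> ('I_n -> X -> R) -> R) : Prop := {
  hc_linl : forall c f g h pi, hoelder_c X a f -> hoelder_c X a g ->
    (forall i, hoelder_loc X (b i) (pi i)) ->
    (forall x, h x = c * f x + g x) -> T h pi = c * T f pi + T g pi ;
  hc_linr : forall c f pi i p q r, hoelder_c X a f ->
    (forall i, hoelder_loc X (b i) (pi i)) ->
    hoelder_loc X (b i) p -> hoelder_loc X (b i) q ->
    (forall x, r x = c * p x + q x) ->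
    T f (dfwith pi i r) = c * T f (dfwith pi i p) + T f (dfwith pi i q) ;
  hc_local : forall f pi i, hoelder_c X a f ->
    (forall i, hoelder_loc X (b i) (pi i)) ->
    (exists2 U, set_nbhs (spt f) U & exists c, forall x, U x -> pi i x = c) ->
    T f pi = 0 ;
  hc_continuous : forall f_ pi_ f pi,
    (forall j, hoelder_c X a (f_ j)) ->
    (forall j i, hoelder_loc X (b i) (pi_ j i)) ->
    hoelder_c X a f -> (forall i, hoelder_loc X (b i) (pi i)) ->
    {uniform, (fun j => f_ j) @ \oo --> f} ->
    (exists M, forall j, hoelder_bound a setT (f_ j) M) ->
    (exists2 K : set X, compact K & forall j, spt (f_ j) `<=` K) ->
    (forall (K : set X) i, compact K ->
      (exists M, forall j, hoelder_bound (b i) K (pi_ j i) M) /\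
      {uniform K, (fun j => pi_ j i) @ \oo --> pi i}) ->
    T (f_ j) (pi_ j) @[j --> \oo] --> T f pi
}.

Lemma dfwith_pred (I : eqType) (Y : Type) (P : I -> Y -> Prop) (f : I -> Y) i y :
  (forall j, P j (f j)) -> P i y -> forall j, P j (dfwith f i y j).
Proof. by move=> fP yP j; case: dfwithP. Qed.

Lemma dfwith_id (I : eqType) (Y : Type) (f : I -> Y) i : dfwith f i (f i) = f.
Proof. by apply/funext => j; case: dfwithP. Qed.

Section HoelderCurrents.
Context {R : realType} {X : metricType R} {n : nat} {a : R} {b : 'I_n -> R}.
Context (T : (X -> R) -> ('I_n -> X -> R) -> R).
Context (HT : hoelder_current a b T).
Context (a01 : 0 < a <= 1).
Context (b01 : forall i, 0 < b i <= 1).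
Implicit Types (f g : X -> R) (pi rho : 'I_n -> X -> R).

Let a0 : 0 <= a. Proof. by case/andP: a01 => /ltW. Qed.

Lemma hc_zero pi : (forall i, hoelder_loc X (b i) (pi i)) -> T (fun=> 0) pi = 0.
Proof.
move=> pib; have c0 := @hoelder_c0 R X a.
have := @hc_linl _ _ _ _ _ _ HT 1 _ _ (fun=> 0) pi c0 c0 pib.
move=> h; have /h : X -> 0 = 1 * 0 + 0 :> R by rewrite mulr0 addr0.
rewrite mul1r => /eqP.
by rewrite -subr_eq0 opprD addNKr oppr_eq0 => /eqP.
Qed.

Lemma hcZl c f h pi : hoelder_c X a f -> (forall i, hoelder_loc X (b i) (pi i)) ->
  (forall x, h x = c * f x) -> T h pi = c * T f pi.
Proof.
move=> fa pib hf; rewrite (@hc_linl _ _ _ _ _ _ HT c f (fun=> 0) h) ?hc_zero ?addr0//.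
  exact: hoelder_c0.
by move=> x; rewrite addr0.
Qed.

Lemma hcDl f g h pi : hoelder_c X a f -> hoelder_c X a g ->
  (forall i, hoelder_loc X (b i) (pi i)) ->
  (forall x, h x = f x + g x) -> T h pi = T f pi + T g pi.
Proof.
move=> fa ga pib hf; rewrite (@hc_linl _ _ _ _ _ _ HT 1 f g h) ?mul1r//.
by move=> x; rewrite mul1r.
Qed.

(* The functions truncation (1/j) \o f converge to f and their supports lie
   inside the open set where f does not vanish. *)
Lemma hc_strong_local f pi i c : hoelder_c X a f ->
    (forall i, hoelder_loc X (b i) (pi i)) ->
    (forall x, f x != 0 -> pi i x = c) -> T f pi = 0.
Proof.
move=> fa pib fc; case: (fa) => -[C fC] cf.
pose f_ j := truncation (j.+1%:R^-1 : R) \o f.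
have fC_ j : hoelder_bound a setT (f_ j) C.
  by apply: hoelder_bound_comp fC => s t; apply: truncation_lip; rewrite invr_ge0.
have sf j : spt (f_ j) `<=` spt f.
  apply: spt_sub => x; apply: contra_neq => fx0.
  by rewrite /f_/= truncation_eq0// fx0 normr0 invr_ge0.
have fa_ j : hoelder_c X a (f_ j).
  by split; [exists C|exact: spt_compact cf (sf j)].
have T0 j : T (f_ j) pi = 0.
  apply: (hc_local HT (i := i)) => //; exists [set x | f x != 0]; last by exists c.
  move=> x /= sx; have a_gt0 : 0 < a by case/andP: a01.
  have j0 : 0 < j.+1%:R^-1 :> R by rewrite invr_gt0.
  (* A point [x] of the support of [f_ j] has nearby points [y] with [f_ j y != 0]. There [|f y|]
     exceeds the threshold, so [f x = 0] would contradict the closeness of [f x] and [f y]. *)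
  have [y [/= fy xy]] := sx _ (hoelder_bound_near x a_gt0 fC j0).
  have fx : f x != 0.
    apply: contra_neq fy => fx0; apply: truncation_eq0.
    by move: xy; rewrite fx0 sub0r normrN => /ltW.
  apply: filterS (hoelder_bound_near x a_gt0 fC (_ : 0 < `|f x|)); last by rewrite normr_gt0.
  by move=> z /=; apply: contraTneq => ->; rewrite subr0 ltxx.
have f_f : {uniform, (fun j => f_ j) @ \oo --> f}.
  apply: (cvg_uniform_dist (u := fun j => j.+1%:R^-1)); last exact: cvg_harmonic.
  by move=> j x _; apply: truncation_dist; rewrite invr_ge0.
have : T (f_ j) pi @[j --> \oo] --> T f pi.
  apply: (hc_continuous HT (pi_ := fun=> pi)) => //.
  - by exists C.
  - by exists (spt f).
  - move=> K k cK; split; last first.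
      apply: (cvg_uniform_dist (u := fun=> 0)); last exact: cvg_cst.
      by move=> j x _; rewrite subrr normr0.
    have /andP[/ltW bk0 _] := b01 k.
    by have [D piD] := hoelder_loc_compact bk0 (pib k) cK; exists D.
under eq_cvg do rewrite T0.
by move=> /(cvg_unique (@Rhausdorff R) (cvg_cst (0 : R))).
Qed.

(** By linearity the difference of the two sides has the slot [p - q], which vanishes where [f] does
    not; strong locality applies with the constant 0. *)
Lemma hc_linr_strong f pi i p q : hoelder_c X a f ->
    (forall i, hoelder_loc X (b i) (pi i)) ->
    hoelder_loc X (b i) p -> hoelder_loc X (b i) q ->
    (forall x, f x != 0 -> p x = q x) ->
  T f (dfwith pi i p) = T f (dfwith pi i q).
Proof.
move=> fa pib pb qb pq.
have := @hc_linr _ _ _ _ _ _ HT (- 1) f pi i q p (fun x => - 1 * q x + p x) fa pib qb pb.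
rewrite (@hc_strong_local f (dfwith pi i _) i 0)//; last 2 first.
- by apply: (dfwith_pred (P := fun j => hoelder_loc X (b j))) => //; exact: hoelder_locD.
- by move=> x fx; rewrite dfwithin pq// mulN1r addNr.
by move=> /(_ (fun=> erefl)) /esym/eqP; rewrite mulN1r addrC subr_eq0 => /eqP.
Qed.

Lemma hc_congr f pi rho : hoelder_c X a f ->
    (forall i, hoelder_loc X (b i) (pi i)) ->
    (forall i, hoelder_loc X (b i) (rho i)) ->
    (forall i x, f x != 0 -> pi i x = rho i x) -> T f pi = T f rho.
Proof.
move=> fa pib rhob pirho.
(* The slots are exchanged one at a time: [mix s] has already switched to [rho] at the indices in
   [s]. *)
pose mix (s : seq 'I_n) := fun i => if i \in s then rho i else pi i.
have mixb s i : hoelder_loc X (b i) (mix s i) by rewrite /mix; case: ifP.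
have mixT s : T f (mix s) = T f pi.
  elim: s => [|i s <-]; first by congr (T _ _); apply/funext.
  have -> : mix (i :: s) = dfwith (mix s) i (rho i).
    apply/funext => j; rewrite /mix inE; case: dfwithP => [|k]; first by rewrite eqxx.
    by rewrite eq_sym => /negbTE ->.
  rewrite -[in RHS](dfwith_id (mix s) i).
  apply: hc_linr_strong => // x fx; rewrite /mix; case: ifP => // _.
  by rewrite pirho.
by rewrite -(mixT (enum 'I_n)); congr (T _ _); apply/funext => i; rewrite /mix mem_enum.
Qed.
End HoelderCurrents.

Section LipschitzFunctions.
Context {R : realType} {X : metricType R}.
Implicit Types (f g : X -> R).

Definition lip g := exists C, hoelder_bound 1 setT g C.

Lemma lip_comp g (h : R -> R) : (forall s t, `|h s - h t| <= `|s - t|) ->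
  lip g -> lip (h \o g).
Proof. by move=> h1 [C gC]; exists C; exact: hoelder_bound_comp. Qed.

Lemma lipD c f g : lip f -> lip g -> lip (fun x => c * f x + g x).
Proof.
move=> [C fC] [D gD]; exists (`|c| * C + D).
by apply: hoelder_boundD => //; exact: hoelder_boundZ.
Qed.

Lemma lip_cst c : lip (fun=> c).
Proof. by exists 0; exact: hoelder_bound_cst. Qed.

Lemma lip_affine c d g : lip g -> lip (fun x => c * g x + d).
Proof. by move=> gl; apply: lipD gl (lip_cst d). Qed.

Lemma lip_hoelder_loc b g : 0 < b <= 1 -> lip g -> hoelder_loc X b g.
Proof. by move=> b01 [C gC]; apply: hoelder_loc_lip => //; exact: hoelder_bound_loc gC. Qed.

Lemma hoelder_c1_mul f g : hoelder_c X 1 f -> lip g ->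
  (forall x, `|g x| <= 1) -> hoelder_c X 1 (fun x => f x * g x).
Proof. by move=> fc [C gC] g1; exact: (hoelder_c_mul ler01 fc gC ler01). Qed.

End LipschitzFunctions.

(** * Integer-valued slots and the folding identity *)

Section LipschitzVanishing.
Context {R : realType} {X : metricType R} {n : nat} {a : R} {b : 'I_n -> R}.
Context (T : (X -> R) -> ('I_n -> X -> R) -> R).
Context (HT : hoelder_current a b T).
Context (a01 : 0 < a <= 1).
Context (b01 : forall i, 0 < b i <= 1).
Implicit Types (f g : X -> R) (pi rho : 'I_n -> X -> R).

Let Lc f : hoelder_c X 1 f -> hoelder_c X a f.
Proof. exact: hoelder_c_lip. Qed.

Let Ll pi : (forall i, lip (pi i)) -> forall i, hoelder_loc X (b i) (pi i).
Proof. by move=> pil i; exact: lip_hoelder_loc. Qed.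

Let dfwith_lip pi i p : (forall i, lip (pi i)) -> lip p ->
  forall j, lip (dfwith pi i p j).
Proof. exact: (dfwith_pred (P := fun _ => lip)). Qed.

Lemma hc_slotD c f pi i p q : hoelder_c X 1 f -> (forall i, lip (pi i)) ->
  lip p -> lip q ->
  T f (dfwith pi i (fun x => c * p x + q x)) =
  c * T f (dfwith pi i p) + T f (dfwith pi i q).
Proof.
move=> fc pil pl ql; apply: (hc_linr HT) => //; first exact: Lc.
all: by [exact: Ll|exact: lip_hoelder_loc].
Qed.

Lemma hc_slot_cst f pi i d : hoelder_c X 1 f -> (forall i, lip (pi i)) ->
  T f (dfwith pi i (fun=> d)) = 0.
Proof.
move=> fc pil; apply: (hc_strong_local HT a01 b01 (i := i) (c := d)).
- exact: Lc.
- by apply: Ll; apply: dfwith_lip => //; exact: lip_cst.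
- by move=> x _; rewrite dfwithin.
Qed.

Lemma hc_slot_affine c d f pi i p : hoelder_c X 1 f -> (forall i, lip (pi i)) ->
  lip p ->
  T f (dfwith pi i (fun x => c * p x + d)) = c * T f (dfwith pi i p).
Proof.
move=> fc pil pl; rewrite (@hc_slotD c f pi i p (fun=> d))//; last exact: lip_cst.
by rewrite hc_slot_cst// addr0.
Qed.

(** Induction on [N] through the Lipschitz splitting [f = f g + f (1 - g)] with [g = clamp o p].
    Where [f g] is nonzero, [p >= 1], so [p - 1] is natural and at most [N], and subtracting 1 does
    not change the value of [T]. Where [f (1 - g)] is nonzero, [p = 0]. *)
Lemma hc_slot_nat f pi i p N : hoelder_c X 1 f -> (forall i, lip (pi i)) ->
  lip p -> (forall x, f x != 0 -> exists2 k, (k <= N)%N & p x = k%:R) ->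
  T f (dfwith pi i p) = 0.
Proof.
elim: N f p => [|N IH] f p fc pil pl pN.
  rewrite -(@hc_slot_cst f pi i 0)//.
  apply: (hc_linr_strong HT) => //; [exact: Lc|exact: Ll|exact: lip_hoelder_loc| |].
    by apply: lip_hoelder_loc => //; exact: lip_cst.
  by move=> x /pN [[|//] _ ->].
pose g : X -> R := clamp \o p.
have gl : lip g by apply: lip_comp pl; exact: clamp_lip.
have fgc : hoelder_c X 1 (fun x => f x * g x).
  by apply: hoelder_c1_mul => // x; exact: norm_clamp_le1.
have fgc' : hoelder_c X 1 (fun x => f x * (-1 * g x + 1)).
  have -> : (fun x => f x * (-1 * g x + 1)) = (fun x => -1 * (f x * g x) + f x).
    by apply/funext => x; ring.
  exact: hoelder_cD.
have clamp0 : clamp 0 = 0 :> R by rewrite /clamp sub0r maxxx max_l ?subr0// lerN10.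
have clampS k : clamp k.+1%:R = 1 :> R.
  have := ler0n R k; have := ler0n R k.+1; rewrite /clamp -natr1 => ? ?.
  by rewrite !max_r ?addrK//; ring.
rewrite (@hcDl _ _ _ _ _ _ HT (fun x => f x * g x) (fun x => f x * (-1 * g x + 1))).
- rewrite [X in _ + X](_ : _ = 0) ?addr0; last first.
    rewrite -(@hc_slot_cst (fun x => f x * (-1 * g x + 1)) pi i 0)//.
    apply: (hc_linr_strong HT) => //; [exact: Lc|exact: Ll|exact: lip_hoelder_loc| |].
      by apply: lip_hoelder_loc => //; exact: lip_cst.
    move=> x; rewrite mulf_eq0 negb_or => /andP[/pN [[|k] _ px]]; first by rewrite px.
    by rewrite /g/= px clampS mulN1r addNr eqxx.
  have := @hc_slot_affine 1 (-1) (fun x => f x * g x) pi i p fgc pil pl.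
  rewrite mul1r => <-; apply: IH => //; first exact: lip_affine.
  move=> x; rewrite mulf_eq0 negb_or => /andP[/pN [[|k] kN px]].
    by rewrite /g/= px clamp0 eqxx.
  by move=> _; exists k => //; rewrite px mul1r -natr1 addrK.
- exact: Lc.
- exact: Lc.
- by apply: Ll; exact: dfwith_lip.
- by move=> x; ring.
Qed.

(** A constant [N] above [|p|] on the compact support of [f] shifts the slot to naturals between 0
    and [2N] without changing [T]. *)
Lemma hc_slot_int f pi i p : hoelder_c X 1 f -> (forall i, lip (pi i)) ->
  lip p -> (forall x, f x != 0 -> exists m : int, p x = m%:~R) ->
  T f (dfwith pi i p) = 0.
Proof.
move=> fc pil pl pZ.
have l1 : 0 < (1 : R) <= 1 by rewrite ltr01 lexx.
have [M M0 pM] := hoelder_loc_bounded ler01 (lip_hoelder_loc l1 pl) fc.2.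
pose N := Num.bound M; have MN : M < N%:R by exact: archi_boundP.
have := @hc_slot_affine 1 N%:R f pi i p fc pil pl; rewrite mul1r => <-.
apply: (@hc_slot_nat _ _ _ _ (N + N)) => //; first exact: lip_affine.
move=> x fx; have [m pm] := pZ x fx; have := pM x (spt_id fx).
rewrite ler_norml pm => /andP[Mm mM].
have mN0 : 0 <= m + N%:Z.
  rewrite -(ler_int R) intrD; move: Mm MN; rewrite -pmulrn; lra.
exists (absz (m + N%:Z)); last first.
  by rewrite mul1r [RHS]pmulrn gez0_abs// intrD -pmulrn.
rewrite -lez_nat gez0_abs// PoszD lerD2r -(ler_int R) -pmulrn.
by apply/ltW/(le_lt_trans mM).
Qed.

(* On {wave v > 0} the function distZ v - v takes integer values, and so does
   distZ v + v on {wave v < 0}. *)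
Lemma hc_fold f pi i v : hoelder_c X 1 f -> (forall i, lip (pi i)) -> lip v ->
  T (fun x => f x * `|wave (v x)|) (dfwith pi i v) =
  T (fun x => f x * wave (v x)) (dfwith pi i (distZ \o v)).
Proof.
move=> fc pil vl.
have zl : lip (distZ \o v) by apply: lip_comp vl; exact: distZ_lip.
pose pos t : R := Num.max 0 (wave t); pose neg t : R := Num.max 0 (- wave t).
have maxlip s t : `|Num.max 0 s - Num.max 0 t| <= `|s - t| :> R.
  case: (leP 0 s) => ?; case: (leP 0 t) => ?; rewrite ?subrr ?normr0//.
    by rewrite subr0 !ger0_norm; lra.
  by rewrite sub0r !normrN distrC !ger0_norm; lra.
have max1 s : `|s| <= 1 -> `|Num.max 0 s| <= 1 :> R.
  by case: (leP 0 s) => // _ _; rewrite normr0.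
have posc : hoelder_c X 1 (fun x => f x * pos (v x)).
  apply: (@hoelder_c1_mul _ _ f (pos \o v)) => //; last by move=> x; exact: max1 (norm_wave_le1 _).
  by apply: lip_comp vl => s t; rewrite (le_trans (maxlip _ _))// wave_lip.
have negc : hoelder_c X 1 (fun x => f x * neg (v x)).
  apply: (@hoelder_c1_mul _ _ f (neg \o v)) => //.
    by apply: lip_comp vl => s t; rewrite (le_trans (maxlip _ _))// -opprD normrN wave_lip.
  by move=> x; apply: max1; rewrite normrN norm_wave_le1.
have posE : T (fun x => f x * pos (v x)) (dfwith pi i (distZ \o v)) =
            T (fun x => f x * pos (v x)) (dfwith pi i v).
  apply/eqP; rewrite -subr_eq0 addrC -mulN1r -hc_slotD//; apply/eqP.
  apply: hc_slot_int => //; first exact: lipD.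
  move=> x; rewrite mulf_eq0 negb_or => /andP[_]; have [m] := wave_distZ (v x).
  rewrite /pos => -[[_ /= ->] _|[w0 _]]; last by rewrite max_l ?eqxx// ltW.
  by exists (- m); rewrite intrN; ring.
have negE : T (fun x => f x * neg (v x)) (dfwith pi i (distZ \o v)) =
            - T (fun x => f x * neg (v x)) (dfwith pi i v).
  apply/eqP; rewrite -subr_eq0 opprK addrC -[X in X + _]mul1r -hc_slotD//; apply/eqP.
  apply: hc_slot_int => //; first exact: lipD.
  move=> x; rewrite mulf_eq0 negb_or => /andP[_]; have [m] := wave_distZ (v x).
  rewrite /neg => -[[w0 _]|[_ /= ->] _]; first by rewrite max_l ?eqxx// oppr_le0.
  by exists m; ring.
have vb := Ll (dfwith_lip i pil vl); have zb := Ll (dfwith_lip i pil zl).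
rewrite (@hcDl _ _ _ _ _ _ HT (fun x => f x * pos (v x)) (fun x => f x * neg (v x)))//; last first.
- move=> x; rewrite -mulrDr; congr (_ * _); rewrite /pos /neg.
  by case: (leP 0 (wave (v x))) => ?; case: (leP 0 (- wave (v x))) => ?;
    [rewrite ger0_norm|rewrite ger0_norm|rewrite ltr0_norm|]; lra.
- exact: Lc.
- exact: Lc.
rewrite (@hc_linl _ _ _ _ _ _ HT (-1) (fun x => f x * neg (v x))
  (fun x => f x * pos (v x)) (fun x => f x * wave (v x)))//.
- by rewrite posE negE mulN1r opprK addrC.
- exact: Lc.
- exact: Lc.
- move=> x; rewrite /pos /neg.
  have [w0|w0] := leP 0 (wave (v x)); first by rewrite max_l ?oppr_le0//; ring.
  by rewrite max_r ?oppr_ge0 ?ltW//; ring.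
Qed.

End LipschitzVanishing.

(** * Oscillation *)

Section Oscillation.
Context {R : realType} {X : metricType R} {n : nat} {a : R} {b : 'I_n -> R}.
Context (T : (X -> R) -> ('I_n -> X -> R) -> R).
Context (HT : hoelder_current a b T).
Context (a01 : 0 < a <= 1).
Context (b01 : forall i, 0 < b i <= 1).
Implicit Types (f g : X -> R) (pi rho : 'I_n -> X -> R) (e : R) (sg : 'I_n -> R).

(** The identity [|wave u| + |wave (u + 1/4)| = 1/4] splits [f] into two parts, each of which can be
    folded; [s] is the shift of the part with the larger contribution. *)
Lemma hc_wave f pi i u : hoelder_c X 1 f -> (forall i, lip (pi i)) -> lip u ->
  exists s, `|T f (dfwith pi i u)| <=
    8 * `|T (fun x => f x * wave (u x + s))
            (dfwith pi i (fun x => distZ (u x + s)))|.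
Proof.
move=> fc pil ul.
have ushift s : lip (fun x => u x + s) by have [C uC] := ul; exists (C + 0);
  apply: hoelder_boundD => //; exact: hoelder_bound_cst.
have wl s : hoelder_c X 1 (fun x => f x * `|wave (u x + s)|).
  apply: (@hoelder_c1_mul _ _ f (fun x => `|wave (u x + s)|)) => //.
    apply: (lip_comp (h := fun t => `|wave t|) _ (ushift s)) => t t'.
    by rewrite (le_trans (ler_dist_dist _ _))// wave_lip.
  by move=> x; rewrite normr_id norm_wave_le1.
pose A s := T (fun x => f x * `|wave (u x + s)|) (dfwith pi i u).
(* Adding the constant [s] to the slot does not change [T], so the folding identity applies to
   [u + s]. *)
have AE s : A s = T (fun x => f x * wave (u x + s)) (dfwith pi i (fun x => distZ (u x + s))).
  rewrite /A -[X in _ = X](hc_fold HT a01 b01 i fc pil (ushift s)).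
  rewrite -[LHS]mul1r -(hc_slot_affine HT a01 b01 1 s i (wl s) pil ul).
  by congr (T _ (dfwith _ _ _)); apply/funext => x; rewrite mul1r.
have TA : T f (dfwith pi i u) = 4 * (A 0 + A (1 / 4)).
  have uloc k : hoelder_loc X (b k) (dfwith pi i u k).
    exact: (dfwith_pred (P := fun j => hoelder_loc X (b j)))
      (fun j => lip_hoelder_loc (b01 j) (pil j)) (lip_hoelder_loc (b01 i) ul) k.
  rewrite /A -(@hcDl _ _ _ _ _ _ HT _ _ (fun x => 4^-1 * f x))//; last 3 first.
  - exact: hoelder_c_lip a01 (wl 0).
  - exact: hoelder_c_lip a01 (wl (1 / 4)).
  - by move=> x; rewrite addr0 -mulrDr wave_partition mul1r mulrC.
  rewrite [X in 4 * X](@hcZl _ _ _ _ _ _ HT 4^-1 f _ _ (hoelder_c_lip a01 fc))//.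
  by rewrite mulrA divff ?mul1r// pnatr_eq0.
(* The larger of the two values carries at least half of the sum, which turns the factor 4 into
   8. *)
have [A01|A10] := leP `|A 0| `|A (1 / 4)|; [exists (1 / 4)|exists 0];
  rewrite -AE TA normrM ger0_norm//; have := ler_normD (A 0) (A (1 / 4)); lra.
Qed.

(** Writing [pi i = e u] gives a factor [e] by linearity. It is split as [e^(1 - b i) e^(b i)], and
    the second factor goes into the slot, where it normalises the oscillation of [distZ] at scale
    [e] to a bounded Hölder constant of order [b i]. *)
Lemma hc_step e f pi i : 0 < e -> hoelder_c X 1 f -> (forall i, lip (pi i)) ->
  exists s, `|T f pi| <= 8 * e `^ (1 - b i) *
    `|T (fun x => f x * wave (pi i x / e + s))
        (dfwith pi i (fun x => e `^ b i * distZ (pi i x / e + s)))|.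
Proof.
move=> e0 fc pil; have en0 : e != 0 by rewrite gt_eqF.
(* The added 0 gives [u] the shape expected by [hc_slot_affine] and [lip_affine]. *)
pose u x := e^-1 * pi i x + 0.
have ul : lip u by exact: lip_affine.
have [s us] := hc_wave i fc pil ul; exists s.
have -> : T f pi = e * T f (dfwith pi i u).
  rewrite -(hc_slot_affine HT a01 b01 e 0 i fc pil ul) -[in LHS](dfwith_id pi i).
  by congr (T _ (dfwith _ _ _)); apply/funext => x; rewrite /u !addr0 mulVKf.
have ushift : lip (fun x => distZ (u x + s)).
  apply: (lip_comp (h := distZ) distZ_lip (g := fun x => u x + s)).
  by have [C uC] := ul; exists (C + 0); apply: hoelder_boundD => //; exact: hoelder_bound_cst.
have wc : hoelder_c X 1 (fun x => f x * wave (u x + s)).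
  apply: (@hoelder_c1_mul _ _ f (fun x => wave (u x + s))) => //; last by move=> x; exact: norm_wave_le1.
  apply: (lip_comp (h := wave) wave_lip (g := fun x => u x + s)).
  by have [C uC] := ul; exists (C + 0); apply: hoelder_boundD => //; exact: hoelder_bound_cst.
have uE x : pi i x / e + s = u x + s by rewrite /u addr0 mulrC.
have -> : T (fun x => f x * wave (pi i x / e + s))
    (dfwith pi i (fun x => e `^ b i * distZ (pi i x / e + s))) =
    e `^ b i * T (fun x => f x * wave (u x + s)) (dfwith pi i (fun x => distZ (u x + s))).
  rewrite -(hc_slot_affine HT a01 b01 (e `^ b i) 0 i wc pil ushift).
  by congr (T _ (dfwith _ _ _)); apply/funext => x; rewrite ?addr0 uE.
rewrite !normrM (gtr0_norm e0) (gtr0_norm (powR_gt0 _ e0)).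
rewrite -(mulrA 8) (mulrA (e `^ _) (e `^ _)) -powRD ?en0 ?implybT// subrK powRr1 ?(ltW e0)//.
by rewrite mulrCA ler_wpM2l// ltW.
Qed.

Definition waves e pi sg (s : seq 'I_n) (x : X) : R :=
  \prod_(i <- s) wave (pi i x / e + sg i).

Lemma waves_le1 e pi sg s x : `|waves e pi sg s x| <= 1.
Proof.
rewrite /waves normr_prod; elim: s => [|i s IH]; first by rewrite big_nil.
by rewrite big_cons mulr_ile1 ?norm_wave_le1// prodr_ge0.
Qed.

(** Every factor is bounded by 1, so the product rule simply adds the Lipschitz constants [C i / e]
    of the factors. *)
Lemma waves_lip e pi sg s (C : 'I_n -> R) : 0 < e ->
    (forall i, hoelder_bound 1 setT (pi i) (C i)) ->
  hoelder_bound 1 setT (waves e pi sg s) (\sum_(i <- s) C i / e).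
Proof.
move=> e0 piC; elim: s => [|i s IH].
  rewrite big_nil.
  have -> : waves e pi sg [::] = fun=> 1 by apply/funext => x; rewrite /waves big_nil.
  exact: hoelder_bound_cst.
have -> : waves e pi sg (i :: s) = fun x => wave (pi i x / e + sg i) * waves e pi sg s x.
  by apply/funext => x; rewrite /waves big_cons.
rewrite big_cons -[C i / e]mulr1 -[X in _ + X]mul1r; apply: hoelder_boundM => //.
- by move=> x _; exact: norm_wave_le1.
- by move=> x _; exact: waves_le1.
- have := hoelder_boundD (hoelder_boundZ e^-1 (piC i)) (hoelder_bound_cst 1 setT (sg i)).
  rewrite addr0 ger0_norm ?invr_ge0 ?ltW// mulrC => h.
  have {}h := hoelder_bound_comp wave_lip h.
  suff <- : (wave \o (fun x => e^-1 * pi i x + sg i)) = (fun x => wave (pi i x / e + sg i)) by [].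
  by apply/funext => x /=; rewrite mulrC.
Qed.

Lemma hoelder_c_waves e f pi sg s : 0 < e -> hoelder_c X 1 f ->
  (forall i, lip (pi i)) -> hoelder_c X 1 (fun x => f x * waves e pi sg s x).
Proof.
move=> e0 fc /choice[C piC].
apply: hoelder_c1_mul => //; last by move=> x; exact: waves_le1.
by exists (\sum_(i <- s) C i / e); exact: waves_lip.
Qed.

Lemma hc_iter e f pi (s : seq 'I_n) : 0 < e -> uniq s -> hoelder_c X 1 f ->
    (forall i, lip (pi i)) ->
  exists sg, `|T f pi| <= \prod_(i <- s) (8 * e `^ (1 - b i)) *
    `|T (fun x => f x * waves e pi sg s x)
        (fun i => if i \in s then fun x => e `^ b i * distZ (pi i x / e + sg i)
                  else pi i)|.
Proof.
move=> e0 + fc pil; elim: s => [_|i s IH /= /andP[si us]].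
  exists (fun=> 0); rewrite big_nil mul1r.
  have -> : (fun x => f x * waves e pi (fun=> 0) [::] x) = f.
    by apply/funext => x; rewrite /waves big_nil mulr1.
  exact: lexx.
have [sg sgP] := IH us.
pose pi' (i : 'I_n) := if i \in s
  then fun x => e `^ b i * distZ (pi i x / e + sg i) else pi i.
have pil' j : lip (pi' j).
  rewrite /pi'; case: ifP => // _.
  have -> : (fun x => e `^ b j * distZ (pi j x / e + sg j)) =
            (fun x => e `^ b j * (distZ \o (fun x => e^-1 * pi j x + sg j)) x + 0).
    by apply/funext => x; rewrite /= addr0 mulrC (mulrC e^-1) mulrC.
  by apply: lip_affine; apply: lip_comp; [exact: distZ_lip|exact: lip_affine].
have [t tP] := hc_step i e0 (hoelder_c_waves sg s e0 fc pil) pil'.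
(* Since [i] is not in [s], its slot is still the original [pi i], and the shifts already chosen on
   [s] survive. *)
pose sg' j := if j == i then t else sg j.
exists sg'; apply: le_trans sgP _.
rewrite big_cons mulrAC [leRHS]mulrC ler_wpM2l//.
  by apply: prodr_ge0 => j _; rewrite mulr_ge0// powR_ge0.
rewrite -/pi'; apply: le_trans tP _; rewrite mulrC.
have sE j : j \in s -> sg' j = sg j.
  by rewrite /sg'; case: eqP => // ->; rewrite (negbTE si).
have pi'i : pi' i = pi i by rewrite /pi' (negbTE si).
rewrite mulrC le_eqVlt; apply/orP; left; apply/eqP; congr (_ * `|T _ _|).
- apply/funext => x; rewrite pi'i /waves big_cons -mulrA; congr (_ * _).
  rewrite mulrC; congr (_ * _); first by rewrite /sg' eqxx.
  by apply: eq_big_seq => j js; rewrite sE.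
- apply/funext => j; rewrite in_cons; case: dfwithP => [|k].
    by rewrite eqxx pi'i /sg' eqxx.
  rewrite eq_sym => /negbTE ki; rewrite ki /= /pi'; case: ifP => // ks.
  by rewrite /sg' ki.
Qed.

End Oscillation.

(** * Vanishing on Lipschitz functions as the scale tends to 0 *)

Section VanishingOnLipschitz.
Context {R : realType} {X : metricType R} {n : nat} {a : R} {b : 'I_n -> R}.
Context (T : (X -> R) -> ('I_n -> X -> R) -> R).
Context (HT : hoelder_current a b T).
Context (a01 : 0 < a <= 1).
Context (b01 : forall i, 0 < b i <= 1).
Context (abn : a + \sum_(i < n) b i <= n%:R).
Implicit Types (f g : X -> R) (pi rho : 'I_n -> X -> R) (e : R) (sg : 'I_n -> R).

Let idx := index_enum 'I_n.

(** Here the condition on the exponents enters: the total power of [e] is [n - \sum b i >= a], and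
    [e <= 1]. *)
Lemma prod_scales e : 0 < e <= 1 ->
  \prod_(i <- idx) (8 * e `^ (1 - b i)) <= 8 ^+ n * e `^ a.
Proof.
move=> e01; have /andP[e0 e1] := e01.
rewrite big_split/= prodr_const card_ord ler_wpM2l ?exprn_ge0//.
have -> : \prod_(i <- idx) e `^ (1 - b i) = e `^ (\sum_(i <- idx) (1 - b i)).
  elim: idx => [|i s IH]; first by rewrite !big_nil powRr0.
  by rewrite !big_cons IH -powRD// (gt_eqF e0) implybT.
rewrite big_split/= sumr_const card_ord sumrN ger_powR//.
by rewrite lerBrDr.
Qed.

(** Up to the factor [e^a], the product is bounded by [M] and has Lipschitz constant at most
    [(D + M \sum C i) / e], as [e <= 1]. Interpolation at scale [e] gives a constant free of [e] and
    [sg]. *)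
Lemma hc_osc_hoelder f e pi sg M D (C : 'I_n -> R) : 0 < e <= 1 ->
    hoelder_bound 1 setT f D -> 0 <= M -> (forall x, `|f x| <= M) ->
    (forall i, hoelder_bound 1 setT (pi i) (C i)) ->
  hoelder_bound a setT (fun x => e `^ a * (f x * waves e pi sg idx x))
    (M + M + (D + M * \sum_(i <- idx) C i)).
Proof.
move=> /andP[e0 e1] fD M0 fM piC; have ea0 := powR_gt0 a e0.
have D0 := fD.1.
have C0 : 0 <= \sum_(i <- idx) C i by apply: sumr_ge0 => i _; exact: (piC i).1.
have B0 : 0 <= D + M * \sum_(i <- idx) C i by rewrite addr_ge0 ?mulr_ge0.
have FM x : `|f x * waves e pi sg idx x| <= M.
  by rewrite normrM -[leRHS]mulr1 ler_pM ?waves_le1.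
have := hoelder_boundM M0 ler01 (fun x _ => fM x) (fun x _ => waves_le1 e pi sg idx x)
  fD (waves_lip sg idx e0 piC).
move=> /hoelder_bound1P[_ FL].
apply: (hoelder_bound_interp (e := e)) => //; first exact: addr_ge0 (addr_ge0 M0 M0) B0.
  move=> x y _ _; rewrite -mulrBr normrM gtr0_norm// ler_wpM2l ?(ltW ea0)//.
  rewrite (le_trans (ler_normB _ _))// (@le_trans _ _ (M + M)) ?lerDl//.
  by rewrite lerD.
move=> x y _ _; rewrite -mulrBr normrM gtr0_norm// -mulrA ler_wpM2l ?(ltW ea0)//.
apply: le_trans (FL _ _ I I) _; rewrite mulr1 -mulr_suml.
set S := \sum_(i <- idx) C i in B0 C0 *.
rewrite [X in _ <= _ * X]mulrC [leRHS]mulrA ler_wpM2r ?mdist_ge0// ler_pdivlMr//.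
rewrite mulrDl -(mulrA M) divfK ?gt_eqF// -[leLHS]add0r !lerD ?addr_ge0//.
by rewrite ler_piMr.
Qed.

(** Interpolation at scale [e] again: [distZ] oscillates by less than 1, and its argument has
    Lipschitz constant [D / e]. *)
Lemma hc_osc_slot_hoelder b0 e g s D : 0 < b0 <= 1 -> 0 < e ->
    hoelder_bound 1 setT g D ->
  hoelder_bound b0 setT (fun x => e `^ b0 * distZ (g x / e + s)) (1 + D).
Proof.
move=> b01' e0 /hoelder_bound1P[D0 gD]; have eb0 := powR_gt0 b0 e0.
apply: (hoelder_bound_interp (e := e)) => //; first by rewrite addr_ge0.
  move=> x y _ _; rewrite -mulrBr normrM gtr0_norm// ler_wpM2l ?(ltW eb0)//.
  rewrite (@le_trans _ _ 1)// ?lerDl// ler_norml.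
  have dZ (t : R) : 0 <= distZ t <= 1 / 2 by rewrite distZ_le12 andbT; exact: normr_ge0.
  have /andP[? ?] := dZ (g x / e + s); have /andP[? ?] := dZ (g y / e + s); lra.
move=> x y _ _; rewrite -mulrBr normrM gtr0_norm// -mulrA ler_wpM2l ?(ltW eb0)//.
apply: le_trans (distZ_lip _ _) _.
have -> : g x / e + s - (g y / e + s) = (g x - g y) / e by ring.
rewrite normrM (gtr0_norm (_ : 0 < e^-1)) ?invr_gt0// mulrA ler_wpM2r ?invr_ge0 ?(ltW e0)//.
by apply: le_trans (gD _ _ I I) _; rewrite ler_wpM2r ?mdist_ge0// lerDr.
Qed.

Lemma hc_lip_eq0 f pi : hoelder_c X 1 f -> (forall i, lip (pi i)) -> T f pi = 0.
Proof.
move=> fc pil; have [M M0 fM] := hoelder_c_bounded ler01 fc.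
have [[D fD] cf] := fc; have [C piC] := choice pil.
pose e (j : nat) : R := j.+1%:R^-1.
have e01 j : 0 < e j <= 1 by rewrite invr_gt0 ltr0n/= invf_le1// ler1n.
have e0 j : 0 < e j by case/andP: (e01 j).
(* The shifts depend on the scale [e j]; this does no harm, because the bounds on [F] and [G] below
   are uniform in them. *)
have [sg sgP] := choice (fun j => hc_iter HT a01 b01 (e0 j) (index_enum_uniq 'I_n) fc pil).
pose F j x := e j `^ a * (f x * waves (e j) pi (sg j) idx x).
pose G j i x := e j `^ b i * distZ (pi i x / e j + sg j i).
have Gl j i : hoelder_bound (b i) setT (G j i) (1 + C i) by exact: hc_osc_slot_hoelder.
have FH j := hc_osc_hoelder (sg j) (e01 j) fD M0 fM piC.
have Fsf j : spt (F j) `<=` spt f.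
  by apply: spt_sub => x; rewrite !mulf_eq0 !negb_or => /and3P[].
have Fc j : hoelder_c X a (F j) by split; [eexists; exact: FH|exact: spt_compact cf (Fsf j)].
have Glo j i : hoelder_loc X (b i) (G j i) by exact: hoelder_bound_loc (Gl j i).
(* The power [e^a] left over from the slots is exactly the factor contained in [F], so the remaining
   constant [8^n] is independent of [j]. *)
have TFG j : `|T f pi| <= 8 ^+ n * `|T (F j) (G j)|.
  apply: le_trans (sgP j) _.
  have -> : (fun i => if i \in index_enum 'I_n then G j i else pi i) = G j.
    by apply/funext => i; rewrite mem_index_enum.
  rewrite (@hcZl _ _ _ _ _ _ HT (e j `^ a) (fun x => f x * waves (e j) pi (sg j) idx x) (F j))//.
    rewrite normrM (gtr0_norm (powR_gt0 a (e0 j))) mulrA ler_wpM2r//.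
    exact: prod_scales.
  by apply: hoelder_c_lip => //; exact: hoelder_c_waves.
have a0 : 0 < a by case/andP: a01.
have T0 : T (F j) (G j) @[j --> \oo] --> (0 : R).
  have z0 i : hoelder_loc X (b i) (fun=> 0) by exact: hoelder_loc0.
  rewrite -(hc_zero HT z0).
  apply: (hc_continuous HT) => //.
  - exact: hoelder_c0.
  - apply: (cvg_uniform_dist (u := fun j => e j `^ a * M)); last first.
      by rewrite -(mul0r M); apply: cvgMl; exact: cvg_invn_powR.
    move=> j x _; rewrite subr0 normrM gtr0_norm ?powR_gt0// ler_wpM2l ?powR_ge0//.
    by rewrite normrM -[leRHS]mulr1 ler_pM ?waves_le1.
  - by eexists => j; exact: FH.
  - by exists (spt f).
  - move=> K i cK; split; first by exists (1 + C i) => j; exact: hoelder_boundS (Gl j i).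
    apply: (cvg_uniform_dist (u := fun j => e j `^ b i)); last first.
      by apply: cvg_invn_powR; case/andP: (b01 i).
    move=> j x _; rewrite subr0 normrM gtr0_norm ?powR_gt0// -[leRHS]mulr1.
    by rewrite ler_wpM2l ?powR_ge0// norm_distZ_le1.
apply/eqP; rewrite -normr_le0.
have : 8 ^+ n * `|T (F j) (G j)| @[j --> \oo] --> (0 : R).
  rewrite -(mulr0 (8 ^+ n)); apply: cvgMr; rewrite -(@normr0 _ R); exact: cvg_norm.
move=> h; rewrite -(cvg_lim (@Rhausdorff R) h); apply: limr_ge; first by apply/cvg_ex; exists 0.
by apply: nearW => j; exact: TFG.
Qed.

End VanishingOnLipschitz.

(** * Density of Lipschitz functions *)

Section Approximation.
Context {R : realType} {X : metricType R}.
Implicit Types (f g : X -> R).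

(** McShane's formula, the infimum over [A] of [g y + k x y], for a kernel [k] and a function [g]
    that obeys it up to the defect [d]. It serves twice: with [C d^b] and no defect for extension,
    and with a steep cone for Lipschitz approximation. *)
Lemma inf_convolution (k : X -> X -> R) (d : R) (A : set X) g :
    A !=set0 -> (forall x y, k x y = k y x) ->
    (forall x y z, k x z <= k x y + k y z) ->
    (forall x y, A x -> A y -> g x <= g y + k x y + d) ->
  exists h, (forall x y, `|h x - h y| <= k x y) /\
            (forall x, A x -> g x - d <= h x <= g x + k x x).
Proof.
move=> [x0 Ax0] ksym ktri gk.
pose E x := [set g y + k x y | y in A].
have E0 x : E x !=set0 by exists (g x0 + k x x0), x0.
(* Comparison through a point [z] of [A] bounds the infimum below even at points [x] outside [A]. *)
have lbE x z : A z -> lbound (E x) (g z - d - k z x).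
  move=> Az _ [y Ay <-]; have := gk _ _ Az Ay; have := ktri z x y; lra.
have hlb x : has_lbound (E x) by exists (g x0 - d - k x0 x); exact: lbE.
pose h x := inf (E x); have hE x y : A y -> h x <= g y + k x y.
  by move=> Ay; apply: (ge_inf (hlb x)); exists y.
have hk x y : h x - k x y <= h y.
  apply: lb_le_inf => // _ [z Az <-]; have := hE x z Az; have := ktri x y z; lra.
exists h; split=> [x y|x Ax].
  by have := hk x y; have := hk y x; rewrite ksym ler_norml; lra.
apply/andP; split; last exact: hE.
apply: lb_le_inf => // _ [y Ay <-]; have := gk _ _ Ax Ay; lra.
Qed.

Lemma hoelder_extension b C (K : set X) g : 0 < b <= 1 -> K !=set0 ->
  hoelder_bound b K g C ->
  exists2 h, hoelder_bound b setT h C & forall x, K x -> h x = g x.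
Proof.
move=> b01 K0 [C0 gC]; have b_neq0 : b != 0 by case/andP: b01 => /gt_eqF ->.
have [||x y Kx Ky|h [hk hg]] :=
    @inf_convolution (fun x y => C * mdist x y `^ b) 0 K g K0.
- by move=> x y; rewrite metric_sym.
- move=> x y z; rewrite -mulrDr ler_wpM2l//.
  (* The triangle inequality for [d^b] is that of the snowflake metric. *)
  exact: (@metric_triangle R (snowflake X b01) x y z).
- by rewrite addr0 -lerBlDl (le_trans (ler_norm _))// gC.
exists h; first by split.
move=> x /hg; rewrite subr0 mdistxx powR0// mulr0 addr0 => gh.
by apply/le_anti; rewrite andbC.
Qed.

(* The inf-convolution of g with a cone of slope C t^b / t, which dominates
   C d^b up to C t^b. *)
Lemma lip_approximation b C t g : 0 < b <= 1 -> 0 < t -> hoelder_bound b setT g C ->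
  exists h, [/\ lip h, hoelder_bound b setT h (C + C + C) &
                forall x, `|h x - g x| <= C * t `^ b].
Proof.
move=> /andP[b0 b1] t0 [C0 gC]; have tb0 := powR_gt0 b t0.
pose L := C * t `^ b / t.
have L0 : 0 <= L by rewrite divr_ge0 ?mulr_ge0 ?(ltW t0) ?(ltW tb0).
have cone x y : C * mdist x y `^ b <= L * mdist x y + C * t `^ b.
  have [dt|/ltW td] := leP (mdist x y) t.
    apply: (@le_trans _ _ (C * t `^ b)); last by rewrite lerDr mulr_ge0 ?mdist_ge0.
    by rewrite ler_wpM2l// ge0_ler_powR ?nnegrE ?mdist_ge0 ?(ltW b0) ?(ltW t0).
  apply: (@le_trans _ _ (L * mdist x y)); last by rewrite lerDl mulr_ge0 ?powR_ge0.
  rewrite /L -2!mulrA ler_wpM2l//.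
  have {1}-> : mdist x y = t * (mdist x y / t) by rewrite mulrC divfK ?gt_eqF.
  rewrite powRM ?divr_ge0 ?mdist_ge0 ?(ltW t0)// [t^-1 * _]mulrC ler_wpM2l ?(ltW tb0)//.
  rewrite -[leRHS]powRr1 ?divr_ge0 ?mdist_ge0 ?(ltW t0)// ler_powR//.
  by rewrite ler_pdivlMr// mul1r.
(* The infimum needs a nonempty index set, so an empty space is treated apart. *)
have [x0|X0] := pselect ([set: X] !=set0); last first.
  exists (fun=> 0); split; first exact: lip_cst.
    by split=> [|x]; [rewrite !addr_ge0|case: X0; exists x].
  by move=> x; case: X0; exists x.
have [||x y _ _|h [hk hg]] := @inf_convolution (fun x y => L * mdist x y) (C * t `^ b) setT g x0.
- by move=> x y; rewrite metric_sym.
- by move=> x y z; rewrite -mulrDr ler_wpM2l// metric_triangle.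
- rewrite -addrA -lerBlDl (le_trans (ler_norm _))//.
  by rewrite (le_trans (gC x y I I)) ?cone.
have hg' x : `|h x - g x| <= C * t `^ b.
  have /andP[] := hg x I; rewrite mdistxx mulr0 addr0 => h1 h2.
  have : 0 <= C * t `^ b by rewrite mulr_ge0 ?powR_ge0.
  by rewrite ler_norml; lra.
exists h; split => //.
  by exists L; apply/hoelder_bound1P.
split=> [|x y _ _]; first by rewrite !addr_ge0.
have db0 : 0 <= mdist x y `^ b by exact: powR_ge0.
(* Up to distance [t] the cone lies below [C d^b]. Beyond it, the two errors [C t^b] at [x] and [y]
   are each at most [C d^b]; with the bound for [g] this makes three times [C]. *)
have [dt|/ltW td] := leP (mdist x y) t.
  apply: le_trans (hk x y) _.
  apply: (@le_trans _ _ (C * mdist x y `^ b)); last by rewrite ler_wpM2r// -addrA lerDl addr_ge0.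
  rewrite /L -2!mulrA ler_wpM2l//.
  have [->|dn0] := eqVneq (mdist x y) 0; first by rewrite !mulr0 powR_ge0.
  have d0 : 0 < mdist x y by rewrite lt_neqAle eq_sym dn0 mdist_ge0.
  have {2}-> : mdist x y = t * (mdist x y / t) by rewrite mulrC divfK ?gt_eqF.
  rewrite powRM ?divr_ge0 ?mdist_ge0 ?(ltW t0)// [t^-1 * _]mulrC ler_wpM2l ?(ltW tb0)//.
  by rewrite ger1_powR// divr_gt0//= ler_pdivrMr// mul1r.
have tC : C * t `^ b <= C * mdist x y `^ b.
  by rewrite ler_wpM2l// ge0_ler_powR ?nnegrE ?mdist_ge0 ?(ltW b0) ?(ltW t0).
have := gC x y I I; have := hg' x; have := hg' y.
rewrite !mulrDl !ler_norml; move: tC; lra.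
Qed.

End Approximation.

(** By strong locality only the values of [pi] on the support of [f] matter, so each slot may be
    replaced by a globally Hölder extension. All arguments are then limits of Lipschitz ones with
    bounded Hölder constants, on which [T] vanishes. *)
Lemma hoelder_current_eq0 (R : realType) (X : metricType R) (n : nat) (a : R)
    (b : 'I_n -> R) (T : (X -> R) -> ('I_n -> X -> R) -> R) f pi :
    hoelder_current a b T -> 0 < a <= 1 -> (forall i, 0 < b i <= 1) ->
    a + \sum_(i < n) b i <= n%:R ->
    hoelder_c X a f -> (forall i, hoelder_loc X (b i) (pi i)) ->
  T f pi = 0.
Proof.
move=> HT a01 b01 abn fa pib; have a0 : 0 < a by case/andP: a01.
(* The extension of the slots from the support of [f] needs that support to be nonempty. *)
have [[x0 fx0]|f0] := pselect (exists x, f x != 0); last first.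
  have -> : f = fun=> 0.
    by apply/funext => x; apply: contra_notP f0 => /eqP fx; exists x.
  exact: (hc_zero HT pib).
have [[C fC] cf] := fa.
have /choice[D piD] : forall i, exists D, hoelder_bound (b i) (spt f) (pi i) D.
  move=> i; have /andP[/ltW bi0 _] := b01 i.
  exact: hoelder_loc_compact (pib i) cf.
have sf0 : spt f !=set0 by exists x0; exact: spt_id.
have /choice[rho rhoP] : forall i, exists h,
    hoelder_bound (b i) setT h (D i) /\ forall x, spt f x -> h x = pi i x.
  by move=> i; have [h hD hE] := hoelder_extension (b01 i) sf0 (piD i); exists h.
have rhob i : hoelder_loc X (b i) (rho i) by exact: hoelder_bound_loc (rhoP i).1.
have -> : T f pi = T f rho.
  by apply: (hc_congr HT) => // i x /spt_id/(rhoP i).2.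
pose t (j : nat) : R := j.+1%:R^-1.
have t0 j : 0 < t j by rewrite invr_gt0.
have /choice[h hP] := fun j => lip_approximation a01 (t0 j) fC.
have /choice[G GP] : forall i, exists G, forall j,
    [/\ lip (G j), hoelder_bound (b i) setT (G j) (D i + D i + D i) &
        forall x, `|G j x - rho i x| <= D i * t j `^ b i].
  move=> i.
  have /choice[G GP] := fun j => lip_approximation (b01 i) (t0 j) (rhoP i).1.
  by exists G.
(* The truncation level is the approximation error of [h j]; hence [F j] vanishes wherever [f] does,
   and the supports stay in that of [f]. *)
pose d j := C * t j `^ a.
have d0 j : 0 <= d j by rewrite mulr_ge0 ?fC.1 ?powR_ge0.
pose F j := truncation (d j) \o h j.
have FH j : hoelder_bound a setT (F j) (C + C + C).
  have [_ hC _] := hP j.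
  by apply: hoelder_bound_comp hC => s s'; exact: truncation_lip.
have Fsf j : spt (F j) `<=` spt f.
  apply: spt_sub => x; apply: contra_neq => fx; apply: truncation_eq0.
  by have [_ _ /(_ x)] := hP j; rewrite fx subr0.
have Fc j : hoelder_c X 1 (F j).
  have [hl _ _] := hP j; split; last exact: spt_compact cf (Fsf j).
  by apply: lip_comp hl => s s'; exact: truncation_lip.
have T0 j : T (F j) (G^~ j) = 0.
  by apply: (hc_lip_eq0 HT) => // i; have [] := GP i j.
have : T (F j) (G^~ j) @[j --> \oo] --> T f rho.
  apply: (hc_continuous HT) => //.
  - by move=> j; exact: hoelder_c_lip.
  - by move=> j i; apply: lip_hoelder_loc => //; have [] := GP i j.
  (* One [C] accounts for the truncation and one for the approximation. *)
  - apply: (cvg_uniform_dist (u := fun j => (C + C) * t j `^ a)); last first.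
      by rewrite -(mulr0 (C + C)); apply: cvgMr; exact: cvg_invn_powR.
    move=> j x _; rewrite -[X in X - _](subrK (h j x)) -addrA mulrDl.
    rewrite (le_trans (ler_normD _ _))// lerD//; first exact: truncation_dist.
    by have [_ _] := hP j; apply.
  - by exists (C + C + C).
  - by exists (spt f).
  - move=> K i cK; split.
      by exists (D i + D i + D i) => j; have [_ + _] := GP i j; exact: hoelder_boundS.
    apply: (cvg_uniform_dist (u := fun j => D i * t j `^ b i)); last first.
      rewrite -(mulr0 (D i)); apply: cvgMr; apply: cvg_invn_powR.
      by case/andP: (b01 i).
    by move=> j x _; have [_ _] := GP i j; apply.
under eq_cvg do rewrite T0.
by move=> /(cvg_unique (@Rhausdorff R) (cvg_cst (0 : R))).
Qed.

(** * Currents in snowflake spaces *)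

Section Bare.
Context {R : realType} {X : metricType R} {n : nat} {a : R} {b : 'I_n -> R}.

(** Functions outside the class are sent to 0, an arbitrary default: the conditions on [bare T] only
    concern functions in the class. *)
Definition to_hoelder_c (f : X -> R) : hoelder_c X a :=
  insubd (SigSub (mem_set (hoelder_c0 a)) : hoelder_c X a) f.

Definition to_hoelder_loc (c : R) (f : X -> R) : hoelder_loc X c :=
  insubd (SigSub (mem_set (hoelder_loc0 c)) : hoelder_loc X c) f.

Definition bare (T : functional X n a b) (f : X -> R) (pi : 'I_n -> X -> R) : R :=
  T (to_hoelder_c f) (fun i => to_hoelder_loc (b i) (pi i)).

Lemma to_hoelder_cK f : hoelder_c X a f -> \val (to_hoelder_c f) = f.
Proof. by move=> fa; rewrite insubdK//; exact: mem_set. Qed.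

Lemma to_hoelder_locK c f : hoelder_loc X c f -> \val (to_hoelder_loc c f) = f.
Proof. by move=> fa; rewrite insubdK//; exact: mem_set. Qed.

Lemma hoelder_cP (f : hoelder_c X a) : hoelder_c X a (\val f).
Proof. exact: set_mem (valP f). Qed.

Lemma hoelder_locP c (f : hoelder_loc X c) : hoelder_loc X c (\val f).
Proof. exact: set_mem (valP f). Qed.

Lemma bareE T (f : hoelder_c X a) (pi : forall i, hoelder_loc X (b i)) :
  bare T (\val f) (fun i => \val (pi i)) = T f pi.
Proof.
rewrite /bare /to_hoelder_c valKd; congr (T _ _).
by apply: functional_extensionality_dep => i; rewrite /to_hoelder_loc valKd.
Qed.

Lemma to_hoelder_loc_dfwith (pi : 'I_n -> X -> R) i r :
  (fun j => to_hoelder_loc (b j) (dfwith pi i r j)) =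
  dfwith (fun j => to_hoelder_loc (b j) (pi j)) i (to_hoelder_loc (b i) r).
Proof.
apply: functional_extensionality_dep => j.
have [<-|ij] := eqVneq i j; first by rewrite !dfwithin.
by rewrite !dfwithout.
Qed.

Lemma bare_hoelder_current T : multilinear T -> is_local T -> seq_continuous T ->
  hoelder_current a b (bare T).
Proof.
move=> [linl linr] loc cts; split.
- move=> c f g h pi fa ga pib hE; apply: linl => x.
  rewrite !to_hoelder_cK//.
  by have -> : h = fun x => c * f x + g x by [apply/funext]; exact: hoelder_cD.
- move=> c f pi i p q r fa pib pb qb rE; rewrite /bare !to_hoelder_loc_dfwith.
  apply: linr => x; rewrite !to_hoelder_locK//.
  by have -> : r = fun x => c * p x + q x by [apply/funext]; exact: hoelder_locD.
- move=> f pi i fa pib [U fU [c Uc]]; apply: (loc _ _ i).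
  exists U; first by rewrite to_hoelder_cK.
  by exists c => x Ux; rewrite to_hoelder_locK// Uc.
- move=> f_ pi_ f pi fa_ pib_ fa pib ff [M fM] [K cK fK] pip.
  have fE : (fun j => \val (to_hoelder_c (f_ j))) = f_.
    by apply/funext => j; rewrite to_hoelder_cK.
  have piE i : (fun j => \val (to_hoelder_loc (b i) (pi_ j i))) = pi_ ^~ i.
    by apply/funext => j; rewrite to_hoelder_locK.
  apply: cts.
  + by rewrite fE to_hoelder_cK.
  (* [hoelder_const] is an infimum over all Hölder bounds, so the bound [M] puts it below [M]. *)
  + exists M => j; apply: ereal_inf_lbound; exists M => //.
    by rewrite to_hoelder_cK.
  + by exists K => // j; rewrite to_hoelder_cK.
  + move=> L i /(pip _ i) [[N piN] pic]; split; last by rewrite piE to_hoelder_locK.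
    exists N => j; apply: ereal_inf_lbound; exists N => //.
    by rewrite to_hoelder_locK.
Qed.

End Bare.

(** * Topology and Hölder classes of the snowflake *)

Section SnowflakeTopology.
Context {R : realType} {X : metricType R} {a : R} (a01 : 0 < a <= 1).
Let Y : metricType R := snowflake X a01.

(** [d^a] is small exactly when [d] is, so the identity is a homeomorphism. Compact sets, supports
    and neighborhoods of sets therefore agree in both metrics. *)
Lemma nbhs_snowflake : @nbhs _ Y = @nbhs _ X.
Proof.
have /andP[a0 a1] := a01.
apply/funext => x; apply/seteqP; split => U /nbhs_ballP [e /= e0 eU].
  have [d d0 dP] := powR_small a0 e0.
  apply/nbhs_ballP; exists d => // y; rewrite ball_mdist => xy.
  by apply: eU; rewrite ball_mdist; apply: dP; rewrite mdist_ge0.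
apply/nbhs_ballP; exists (e `^ a) => /=; first exact: powR_gt0.
move=> y; rewrite ball_mdist => xy; apply: eU; rewrite ball_mdist ltNge.
apply/negP => exy; move: xy; rewrite ltNge => /negP; apply.
by apply: ge0_ler_powR; rewrite ?nnegrE ?mdist_ge0 ?(ltW a0) ?(ltW e0).
Qed.

Lemma compact_snowflake (K : set X) : @compact Y K = @compact X K.
Proof. by rewrite /compact /cluster nbhs_snowflake. Qed.

Lemma spt_snowflake (f : X -> R) : @spt R Y f = @spt R X f.
Proof. by rewrite /spt /closure nbhs_snowflake. Qed.

Lemma set_nbhs_snowflake (K : set X) : @set_nbhs Y K = @set_nbhs X K.
Proof. by rewrite /set_nbhs nbhs_snowflake. Qed.

Lemma hoelder_bound_snowflake (A : set X) (f : X -> R) C :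
  @hoelder_bound R Y 1 A f C = @hoelder_bound R X a A f C.
Proof.
rewrite /hoelder_bound; apply/propext; split=> -[C0 fC]; split=> // x y Ax Ay;
  by have := fC x y Ax Ay; rewrite powRr1// powR_ge0.
Qed.

Lemma hoelder_c_snowflake : hoelder_c Y 1 = hoelder_c X a :> set (X -> R).
Proof.
apply/funext => f; rewrite /hoelder_c/= spt_snowflake compact_snowflake.
by under eq_exists do rewrite hoelder_bound_snowflake.
Qed.

Lemma hoelder_loc_snowflake : hoelder_loc Y 1 = hoelder_loc X a :> set (X -> R).
Proof.
apply/funext => f; apply/propext; split=> fx x; have := fx x;
  rewrite nbhs_snowflake => -[U xU [C fC]]; exists U => //; exists C;
  by move: fC; rewrite hoelder_bound_snowflake.
Qed.

(** Uniform convergence of real functions does not involve the metric of the domain; everything else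
    is translated by the equalities above, with exponent 1 for [d^a] becoming exponent [a] for
    [d]. *)
Lemma snowflake_hoelder_current n (T : (X -> R) -> ('I_n -> X -> R) -> R) :
  @hoelder_current R Y n 1 (fun=> 1) T -> @hoelder_current R X n a (fun=> a) T.
Proof.
case; rewrite hoelder_c_snowflake hoelder_loc_snowflake => linl linr loc cts.
split=> //.
- by move=> f pi i fa pib fU; apply: (loc f pi i) => //; rewrite set_nbhs_snowflake spt_snowflake.
- move=> f_ pi_ f pi fa_ pib_ fa pib ff [M fM] [K cK fK] pip.
  apply: cts => //.
  + by exists M => j; rewrite hoelder_bound_snowflake.
  + by exists K; [rewrite compact_snowflake|move=> j; rewrite spt_snowflake].
  + move=> L i; rewrite compact_snowflake => cL; have [[N piN] pic] := pip L i cL.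
    by split=> //; exists N => j; rewrite hoelder_bound_snowflake.
Qed.

End SnowflakeTopology.

(** * Triviality of snowflake currents and non-extension *)

Lemma currents0 (R : realType) (X : metricType R) n : currents X n (fun _ _ => 0).
Proof.
split=> //; last by move=> *; exact: cvg_cst.
by split=> *; rewrite mulr0 addr0.
Qed.

Theorem theorem4p5 (R : realType) (X : metricType R) (n : nat)
    (locX : locally_compact [set: X]) (n_ge1 : (1 <= n)%N) :
  (forall (alpha : R) (alpha01 : 0 < alpha <= 1),
     alpha <= n%:R / n.+1%:R ->
     currents (snowflake X alpha01) n = [set (fun _ _ => 0)]) /\
  (forall (T : functional X n 1 (fun=> 1)) (alpha : R) (beta : 'I_n -> R),
     currents X n T -> T <> (fun _ _ => 0) ->
     0 < alpha <= 1 -> (forall i, 0 < beta i <= 1) ->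
     alpha + \sum_(i < n) beta i <= n%:R ->
     ~ exists Tbar : functional X n alpha beta,
         [/\ extends T Tbar, multilinear Tbar, is_local Tbar
           & seq_continuous Tbar]).
Proof.
split=> [a a01 an|T a b _ T0 a01 b01 abn [Tb [TTb lin loc cts]]].
  apply/seteqP; split=> [T [lin loc cts]|_ ->]; last exact: currents0.
  apply: functional_extensionality_dep => f.
  apply: functional_extensionality_dep => pi.
  have HT := snowflake_hoelder_current (bare_hoelder_current lin loc cts).
  rewrite -bareE; apply: (hoelder_current_eq0 HT) => //.
  (* With all exponents equal to [a] the condition reads [(n + 1) a <= n]. *)
  - by rewrite sumr_const card_ord -mulrS -[leLHS]mulr_natr -ler_pdivlMr.
  - by rewrite -(hoelder_c_snowflake a01); exact: hoelder_cP.
  - by move=> i; rewrite -(hoelder_loc_snowflake a01); exact: hoelder_locP.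
(* An extension vanishes identically, hence so does [T], whose arguments lie in the larger Hölder
   classes. *)
apply: T0; apply: functional_extensionality_dep => f.
apply: functional_extensionality_dep => pi.
have fa : hoelder_c X a (\val f) by apply: hoelder_c_lip => //; exact: hoelder_cP.
have pib i : hoelder_loc X (b i) (\val (pi i)).
  by apply: hoelder_loc_lip => //; exact: hoelder_locP.
rewrite -(TTb f pi (to_hoelder_c (\val f)) (fun i => to_hoelder_loc (b i) (\val (pi i)))).
- exact: (hoelder_current_eq0 (bare_hoelder_current lin loc cts)).
- exact: to_hoelder_cK.
- by move=> i; exact: to_hoelder_locK.
Qed.
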